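(* The entailment problem $P_i \models_{\mathcal{P}} P_j$ (for predicates $P_i,P_j$ of $\mathcal{P}$ with the same number of formal parameters) is undecidable when the inductive system $\mathcal{P}=\{P_i \equiv |_{j=1}^{m_i} R_{i,j}\}_{i=1}^n$ is allowed to contain rules that are not connected.
   Context: States. Let $Var$ be a countably infinite set of variables containing a designated variable $\mathbf{nil}$, $Loc$ a countably infinite set of locations containing a designated $null$, and $Sel=\{1,\dots,\mathcal{S}\}$ a finite set of selectors. A state is a pair $\langle s,h\rangle$ where $s: Var \rightharpoonup Loc$ is a partial function with $s(\mathbf{nil})=null$, and $h: Loc \rightharpoonup_{fin} (Sel \rightharpoonup_{fin} Loc)$ is a finite partial function with $null\notin dom(h)$ and such that for every $\ell\in dom(h)$ some selector $k$ has $h(\ell)(k)$ defined. We write $\ell \xrightarrow{k} \ell'$ for $h(\ell)(k)=\ell'$ (an edge). Basic formulae: with $\alpha\in Var\setminus\{\mathbf{nil}\}$, $x\in Var$: pure formulae $\Pi ::= \alpha = x \mid \Pi_1\wedge\Pi_2$; spatial formulae $\Sigma ::= \mathbf{emp} \mid \alpha\mapsto(x_1,\dots,x_n) \mid \Sigma_1 * \Sigma_2$ ($n>0$); formulae $\varphi ::= \Sigma\wedge\Pi \mid \exists x.\varphi$. Semantics (strict): $\langle s,h\rangle\models \mathbf{emp}$ iff $dom(h)=\emptyset$; $\langle s,h\rangle \models \alpha\mapsto(x_1,\dots,x_n)$ iff $h$ consists of the single cell $s(\alpha)$ whose selectors $1,\dots,n$ are exactly defined and map to $s(x_1),\dots,s(x_n)$;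 $S\models\varphi_1*\varphi_2$ iff $S$ is the union of two states with agreeing stores and disjoint heap domains satisfying $\varphi_1$ and $\varphi_2$ respectively; $\exists$, $=$, $\wedge$ are as in first-order logic. $x=_\Pi y$ means the equality of $x$ and $y$ follows from $\Pi$. Inductive systems. An inductive system $\mathcal{P}$ is a finite set of definitions $P_i(x_{i,1},\dots,x_{i,n_i}) \equiv R_{i,1}\mid\dots\mid R_{i,m_i}$, where each rule has the form $R_{i,j}(\vec x)\equiv \exists\vec z.\ \Sigma * P_{i_1}(\vec y_1)*\dots*P_{i_m}(\vec y_m)\wedge \Pi$ with $\vec x\cap\vec z=\emptyset$, and: (1) the head $\Sigma$ is a spatial formula with $\Sigma\not\equiv\mathbf{emp}$ and $FV(\Sigma)\subseteq \vec x\cup\vec z$; (2) $\vec y_1\cup\dots\cup\vec y_m\subseteq\vec x\cup\vec z$; (3) $\Pi$ is pure with $FV(\Pi)\subseteq\vec x\cup\vec z$, and for every formal parameter $\beta\in\vec x$ the only allowed equalities involving $\beta$ are of the form $\alpha=_\Pi\beta$ with $\alpha$ allocated in $\Sigma$ (i.e. $\alpha$ occurs on the left of some $\mapsto$ in $\Sigma$); (4) a formal parameter is not passed to two different predicate occurrences: if $x_{i,k}\in\vec y_r$, $x_{i,l}\in\vec y_s$ and $x_{i,k}=_\Pi x_{i,l}$ then $r=s$. The size $\|\mathcal{P}\|$ is the sum over rules of their syntactic sizes. Semantics of predicates: an unfolding of $P_i(\vec u)$ is a basic formula obtained from $P_i(\vec u)$ by repeatedly replacing a predicate occurrence $P_k(\vec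 v)$ by the body of one of its rules $R_{k,l}$ with formal parameters instantiated by $\vec v$ and bound variables renamed apart, until no predicate occurrences remain; $S\models P_i(\vec u)$ iff $S$ satisfies some unfolding of $P_i(\vec u)$. For predicates $P_i,P_j$ with the same number $n$ of formal parameters and a tuple $\vec x$ of $n$ variables, the entailment $P_i(\vec x)\models_{\mathcal{P}}P_j(\vec x)$ holds iff every state satisfying $P_i(\vec x)$ satisfies $P_j(\vec x)$. Connectedness. For a quantifier-free $\Sigma\wedge\Pi$, $y$ is reachable from $x$ if there is a sequence $x=_\Pi\alpha_0,\dots,\alpha_m=_\Pi y$ ($m\ge0$) such that each $\alpha_i\mapsto(\beta_{i,1},\dots,\beta_{i,p_i})$ is a points-to atom of $\Sigma$ and $\beta_{i,s}=_\Pi\alpha_{i+1}$ for some $s$. A variable $x$ is a root of $\Sigma$ if every free variable of $\Sigma$ is reachable from $x$. A rule $R_{i,j}(x_{i,1},\dots,x_{i,k})\equiv\exists\vec z.\Sigma*P_{i_1}(\vec y_1)*\dots*P_{i_m}(\vec y_m)\wedge\Pi$ is connected iff there is a formal parameter $x_{i,\ell}$ that is a root of $\Sigma$ and, for each $j=1,\dots,m$, there is an index $s$ such that $(\vec y_j)_s$ is reachable from $x_{i,\ell}$ in $\Sigma\wedge\Pi$ and the $s$-th formal parameter $x_{i_j,s}$ of $P_{i_j}$ is a root of the head of every rule of $P_{i_j}$. A system is connected if all its rules are connected. *)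

(* Defs.v *)
(* Mathematical Components, with finmap for heaps. *)
From mathcomp Require Import all_boot finmap.
From Stdlib Require Import Relation_Operators.

Set Implicit Arguments.
Unset Strict Implicit.
Unset Printing Implicit Defensive.

(** * Formulae *)

(* The countably infinite sets of variables and locations are both taken to be
   [nat]; [nilv] is the variable nil, interpreted by the location [null]. *)
Definition var := nat.
Definition nilv : var := 0.
Definition loc := nat.
Definition null : loc := 0.

(* Predicate occurrences only appear while unfolding; the basic formulae are
   those satisfying [basic].  [Pred k us] is an occurrence of the k-th predicate
   of the ambient system. *)
Inductive formula :=
  | Emp
  | PointsTo (a : var) (xs : seq var)
  | Eq (a x : var)
  | Pred (k : nat) (us : seq var)
  | Star (f g : formula)
  | And (f g : formula)
  | Ex (x : var) (f : formula).

Fixpoint basic (f : formula) : bool :=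
  match f with
  | Emp | PointsTo _ _ | Eq _ _ => true
  | Pred _ _ => false
  | Star f g | And f g => basic f && basic g
  | Ex _ f => basic f
  end.

(** * States and satisfaction *)

Definition store := var -> option loc.

Definition upd (s : store) (x : var) (l : loc) : store :=
  [eta s with x |-> Some l].

(* The selector k of {1, ..., nsel} is represented by the ordinal k - 1. *)
Definition cell (nsel : nat) := {fmap 'I_nsel -> loc}.
Definition heap (nsel : nat) := {fmap loc -> cell nsel}.

Definition is_state (nsel : nat) (s : store) (h : heap nsel) : Prop :=
  [/\ s nilv = Some null,
      null \notin domf h &
      forall l c, h.[? l]%fmap = Some c -> domf c != fset0].

Definition sat_eq (s : store) (a x : var) : Prop :=
  exists l, s a = Some l /\ s x = Some l.

(* In the points-to case, [ls] lists the values of [xs]; the cell is defined on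
   exactly the first [size xs] selectors, which must therefore all exist.  The
   value on [Pred] is irrelevant: only basic formulae are ever interpreted. *)
Fixpoint sat (nsel : nat) (s : store) (h : heap nsel) (f : formula) : Prop :=
  match f with
  | Emp => domf h = fset0
  | PointsTo a xs =>
      exists (l : loc) (c : cell nsel) (ls : seq loc),
        [/\ s a = Some l,
            map s xs = map Some ls,
            size xs <= nsel,
            forall k : 'I_nsel, c.[? k]%fmap = onth ls k &
            h = [fmap].[l <- c]%fmap]
  | Eq a x => sat_eq s a x
  | Pred _ _ => False
  | Star f g =>
      exists h1 h2 : heap nsel,
        [/\ [disjoint domf h1 & domf h2]%fset,
            h = (h1 + h2)%fset,
            sat s h1 f &
            sat s h2 g]
  | And f g => sat s h f /\ sat s h g
  | Ex x f => exists l, sat (upd s x l) h f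
  end.

(** * Inductive systems *)

(* The atoms are those of a spatial formula, separated by *. *)
Definition spatial := seq (var * seq var).
(* A (possibly empty) conjunction of equalities. *)
Definition pure := seq (var * var).

(* exists [exvars]. [head] * P_{i_1}(y_1) * ... * P_{i_m}(y_m) /\ [rpure],
   where [calls] lists the pairs (i_j, y_j). *)
Record rule := Rule {
  exvars : seq var;
  head : spatial;
  calls : seq (nat * seq var);
  rpure : pure }.

Record predicate := Predicate {
  params : seq var;
  rules : seq rule }.

Definition system := seq predicate.

(* [eq_pure p x y] is x =_p y. *)
Definition eq_pure (p : pure) (x y : var) : Prop :=
  forall s : store, s nilv = Some null ->
    (forall a b, (a, b) \in p -> sat_eq s a b) -> s x = s y.

Definition allocated (sg : spatial) (a : var) : Prop :=
  exists xs, (a, xs) \in sg.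

Definition fv_spatial (sg : spatial) : seq var :=
  flatten [seq a.1 :: a.2 | a <- sg].

Definition fv_pure (p : pure) : seq var :=
  flatten [seq [:: e.1; e.2] | e <- p].

(* An equality b =_Pi y involving a formal parameter b must be, up to symmetry,
   of the form "allocated variable = formal parameter"; since both sides may be
   formal parameters, either of them may be the allocated one. *)
Definition param_eqs_ok (xs : seq var) (r : rule) : Prop :=
  forall b y : var, b \in xs -> y != b -> eq_pure (rpure r) y b ->
    allocated (head r) y \/ (allocated (head r) b /\ y \in xs).

Definition params_not_shared (xs : seq var) (r : rule) : Prop :=
  forall (i j : nat) (c d : nat * seq var) (x y : var),
    onth (calls r) i = Some c -> onth (calls r) j = Some d ->
    x \in xs -> y \in xs -> x \in c.2 -> y \in d.2 ->
    eq_pure (rpure r) x y -> i = j.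

(* nil is a variable with a fixed interpretation: it is neither a formal
   parameter nor existentially bound. *)
Definition wf_rule (P : system) (xs : seq var) (r : rule) : Prop :=
  let vs := xs ++ exvars r in
  [/\ uniq vs /\ nilv \notin vs,
      [/\ head r != [::],
          all (fun a => a.2 != [::]) (head r) &
          {subset fv_spatial (head r) <= vs}],
      forall c, c \in calls r ->
        (exists2 d, onth P c.1 = Some d & size c.2 = size (params d)) /\
        {subset c.2 <= vs},
      {subset fv_pure (rpure r) <= vs} &
      param_eqs_ok xs r /\ params_not_shared xs r].

Definition wf_system (P : system) : Prop :=
  forall i d, onth P i = Some d ->
    0 < size (rules d) /\
    forall j r, onth (rules d) j = Some r -> wf_rule P (params d) r.

(** * Unfoldings and entailment *)

(* Simultaneous substitution of [us] for [vs]; variables outside [vs] -- only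
   nil in a well-formed rule -- are sent to nil. *)
Definition inst (vs us : seq var) (x : var) : var :=
  nth nilv us (index x vs).

Definition stars (fs : seq formula) : formula := foldr Star Emp fs.

(* The body of [r] with the formal parameters [xs] replaced by [us] and the
   bound variables renamed to [ws]. *)
Definition body (xs : seq var) (r : rule) (us ws : seq var) : formula :=
  let sb := inst (xs ++ exvars r) (us ++ ws) in
  let sg := [seq PointsTo (sb a.1) (map sb a.2) | a <- head r] in
  let ps := [seq Pred c.1 (map sb c.2) | c <- calls r] in
  let es := [seq Eq (sb e.1) (sb e.2) | e <- rpure r] in
  foldr Ex (foldl And (Star (stars sg) (stars ps)) es) ws.

(* Replacement of one predicate occurrence.  The free variables of a rule body
   are among its actual parameters, so choosing [ws] apart from those suffices
   to avoid capture. *)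
Inductive replace (P : system) : formula -> formula -> Prop :=
  | ReplacePred k us d j r ws :
      onth P k = Some d -> onth (rules d) j = Some r ->
      size us = size (params d) -> size ws = size (exvars r) ->
      uniq ws -> nilv \notin ws -> ~~ has (mem us) ws ->
      replace P (Pred k us) (body (params d) r us ws)
  | ReplaceStarL f f' g : replace P f f' -> replace P (Star f g) (Star f' g)
  | ReplaceStarR f g g' : replace P g g' -> replace P (Star f g) (Star f g')
  | ReplaceAndL f f' g : replace P f f' -> replace P (And f g) (And f' g)
  | ReplaceAndR f g g' : replace P g g' -> replace P (And f g) (And f g')
  | ReplaceEx x f f' : replace P f f' -> replace P (Ex x f) (Ex x f').

Definition unfolding (P : system) (i : nat) (us : seq var) (f : formula) : Prop :=
  clos_refl_trans formula (replace P) (Pred i us) f /\ basic f.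

Definition sat_pred (nsel : nat) (P : system) (s : store) (h : heap nsel)
    (i : nat) (us : seq var) : Prop :=
  exists2 f, unfolding P i us f & sat s h f.

Definition arity (P : system) (i : nat) : option nat :=
  omap (fun d => size (params d)) (onth P i).

Definition entails (nsel : nat) (P : system) (i j : nat) : Prop :=
  forall xs : seq var, arity P i = Some (size xs) ->
  forall (s : store) (h : heap nsel), is_state s h ->
    sat_pred P s h i xs -> sat_pred P s h j xs.

(** * Connectedness *)

Inductive reachable (sg : spatial) (p : pure) : var -> var -> Prop :=
  | ReachEq x y : eq_pure p x y -> reachable sg p x y
  | ReachStep x a bs b y :
      eq_pure p x a -> (a, bs) \in sg -> b \in bs -> reachable sg p b y ->
      reachable sg p x y.

Definition root (r : rule) (x : var) : Prop :=
  forall y, y \in fv_spatial (head r) -> reachable (head r) (rpure r) x y.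

Definition connected_rule (P : system) (xs : seq var) (r : rule) : Prop :=
  exists x, [/\ x \in xs, root r x &
    forall c, c \in calls r ->
      exists (k : nat) (d : predicate) (y z : var),
        [/\ onth c.2 k = Some y,
            reachable (head r) (rpure r) x y,
            onth P c.1 = Some d,
            onth (params d) k = Some z &
            forall j r', onth (rules d) j = Some r' -> root r' z]].

Definition connected_system (P : system) : Prop :=
  forall i d j r, onth P i = Some d -> onth (rules d) j = Some r ->
    connected_rule P (params d) r.

(** * Decidability *)

(* Minsky register machines.  [Dec r j] jumps to instruction [j] if register [r]
   is zero, and otherwise decrements it and falls through.  A machine has
   unboundedly many registers, of which it uses finitely many, and halts when
   the program counter leaves the program. *)
Inductive instr := Inc (r : nat) | Dec (r j : nat).
Definition program := seq instr.

Definition config := (nat * (nat -> nat))%type.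

Definition set_reg (R : nat -> nat) (r v : nat) : nat -> nat :=
  [eta R with r |-> v].

Definition step (p : program) (c : config) : config :=
  let: (pc, R) := c in
  match onth p pc with
  | None => c
  | Some (Inc r) => (pc.+1, set_reg R r (R r).+1)
  | Some (Dec r j) =>
      if R r is v.+1 then (pc.+1, set_reg R r v) else (j, R)
  end.

Definition init (x : nat) : config := (0, fun r => if r == 0 then x else 0).

(* On input [x] in register 0, [p] halts with [y] in register 0. *)
Definition computes (p : program) (x y : nat) : Prop :=
  exists n, let c := iter n (step p) (init x) in size p <= c.1 /\ c.2 0 = y.

(* The problem [Q] on the instances [D], presented to machines via [enc], is
   decidable; nothing is required outside [D]. *)
Definition decidable_on (T : Type) (enc : T -> nat) (D Q : T -> Prop) : Prop :=
  exists p : program, forall t, D t ->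
    exists y, computes p (enc t) y /\ (y = 1 <-> Q t).

(* The instance (P, i, j) asks whether P_i entails P_j. *)
Definition instance := (system * nat * nat)%type.

Definition valid_instance (I : instance) : Prop :=
  let: (P, i, j) := I in
  [/\ wf_system P, i < size P, j < size P & arity P i = arity P j].

Definition instance_connected (I : instance) : Prop :=
  let: (P, _, _) := I in connected_system P.

Definition entailment (nsel : nat) (I : instance) : Prop :=
  let: (P, i, j) := I in entails nsel P i j.

Local Notation gn := CodeSeq.code.

Definition enc_rule (r : rule) : nat :=
  gn [:: gn (exvars r);
         gn [seq gn (a.1 :: a.2) | a <- head r];
         gn [seq gn (c.1 :: c.2) | c <- calls r];
         gn [seq gn [:: e.1; e.2] | e <- rpure r]].

Definition enc_predicate (d : predicate) : nat :=
  gn [:: gn (params d); gn (map enc_rule (rules d))].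

Definition enc_instance (I : instance) : nat :=
  let: (P, i, j) := I in gn [:: gn (map enc_predicate P); i; j].

Lemma enc_instance_inj : injective enc_instance.
Proof.
have gnI : injective gn := can_inj CodeSeq.codeK.
have consI : injective (fun a : nat * seq nat => gn (a.1 :: a.2)).
  by move=> [a s] [b t] /gnI /= [-> ->].
have pairI : injective (fun e : nat * nat => gn [:: e.1; e.2]).
  by move=> [a s] [b t] /gnI /= [-> ->].
have ruleI : injective enc_rule.
  move=> [z1 h1 c1 p1] [z2 h2 c2 p2] /gnI /= [/gnI-> /gnI eh /gnI ec /gnI ep].
  by rewrite (inj_map consI eh) (inj_map consI ec) (inj_map pairI ep).
have predI : injective enc_predicate.
  by move=> [x1 r1] [x2 r2] /gnI /= [/gnI-> /gnI /(inj_map ruleI) ->].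
by move=> [[P i] j] [[P' i'] j'] /gnI [/gnI /(inj_map predI) -> -> ->].
Qed.

(* Main.v *)
Require Import Defs.
From mathcomp Require Import all_boot finmap zify.
From Stdlib Require Import Relation_Operators FunctionalExtensionality.

(** The halting problem of register machines is reduced to entailment.  The run
    of a machine is written as the word of the increments, decrements and
    successful zero tests that it performs.  Words following the control flow
    up to halting form a regular language, and such a word is not an actual run
    if and only if some counter is decremented at zero or passes a zero test
    while positive, which is a context-free condition.  Hence the machine does
    not halt if and only if a language [L(start)] is included in a context-free
    language [L(bad)].

    A word is a heap: a path of cells, where a node with letter [k] is the
    target of [k] further cells.  A production [X -> k B_1 ... B_m] in Greibach
    normal form becomes the (non-connected) rule
    [X(x, y) = exists z w, x |-> z_0 * w_1 |-> x * ... * w_k |-> x *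
     B_1(z_0, z_1) * ... * B_m(z_(m-1), y)], and a heap with decreasing edges
    is read as only one word, so that entailment is language inclusion.

    The input of the machine occurs in one rule only.  Given a decision machine,
    the machine that takes as input the code of the remaining predicates of its
    own system, computes the instance, and halts if and only if the decision is
    positive, contradicts the reduction. *)

Set Implicit Arguments.
Unset Strict Implicit.
Unset Printing Implicit Defensive.

(** * Words as lists of edges *)

Definition edges := seq (loc * loc).

(** The list fixes an order: the edge from [l] to its successor [z], then the edges from the [k]
    auxiliary cells [ds] into [l], then the tail. Distinctness of sources is left to [is_heap]. *)
Fixpoint reads (w : seq nat) (l l' : loc) (es : edges) : Prop :=
  match w with
  | [::] => l = l' /\ es = [::]
  | k :: w1 => exists z ds es1,
      [/\ size ds = k, es = (l, z) :: [seq (d, l) | d <- ds] ++ es1 &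
          reads w1 z l' es1]
  end.

Lemma reads_cat w1 w2 l l' es :
  reads (w1 ++ w2) l l' es <->
  exists z es1 es2, [/\ es = es1 ++ es2, reads w1 l z es1 & reads w2 z l' es2].
Proof.
elim: w1 l es => [|k w1 IH] l es /=.
  split; first by move=> H; exists l, [::], es.
  by case=> z [es1 [es2 [-> [-> ->]]]].
split.
  case=> z [ds [es1 [sz -> /IH [y [e1 [e2 [-> r1 r2]]]]]]].
  exists y, ((l, z) :: [seq (d, l) | d <- ds] ++ e1), e2; split=> //.
    by rewrite /= catA.
  by exists z, ds, e1.
case=> y [e1 [e2 [-> [z [ds [es1 [sz -> r1]]]] r2]]].
exists z, ds, (es1 ++ e2); split=> //; first by rewrite /= catA.
by apply/IH; exists y, es1, e2.
Qed.

(** The heap is built from the end of the word: the new node [n] and the cells pointing to it lie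
    above all earlier sources, so edges decrease and sources stay distinct. *)
Lemma canonical_reading w :
  exists es l n,
    [/\ reads w l null es, l < n, uniq (unzip1 es),
        all (fun e => e.2 < e.1) es & all (fun e => e.1 < n) es].
Proof.
elim: w => [|k w [es [l [n [r ln u d b]]]]]; first by exists [::], 0, 1.
exists ((n, l) :: [seq (x, n) | x <- iota n.+1 k] ++ es), n, (n.+1 + k); split.
- by exists l, (iota n.+1 k), es; split=> //; rewrite size_iota.
- lia.
- have un : unzip1 [seq (x, n) | x <- iota n.+1 k] = iota n.+1 k.
    by rewrite /unzip1 -map_comp map_id.
  have nb x : n <= x -> x \notin unzip1 es.
    move=> nx; apply/negP => /mapP [e /(allP b) eb xe].
    by move: eb; rewrite -xe; lia.
  rewrite /= /unzip1 map_cat -/(unzip1 _) -/(unzip1 es) un mem_cat mem_iota.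
  rewrite (negbTE (nb n _)) // cat_uniq iota_uniq u !andbT /=.
  apply/andP; split; first by lia.
  apply/hasPn => x xe; apply/negP => /=; rewrite mem_iota => xn.
  by move/negP: (nb x ltac:(lia)).
- rewrite /= all_cat ln d andbT /=; apply/allP => e /mapP [x].
  by rewrite mem_iota => xi ->; rewrite /=; lia.
- rewrite /= all_cat; apply/and3P; split; first by lia.
    by apply/allP => e /mapP [x]; rewrite mem_iota => xi -> /=; lia.
  by apply: sub_all b => e; lia.
Qed.

Lemma reads_target_le w l l' es :
  reads w l l' es -> all (fun e => e.2 < e.1) es -> all (fun e => e.2 <= l) es.
Proof.
elim: w l es => [|k w IH] l es /=; first by case=> _ ->.
case=> z [ds [es1 [_ -> r]]] /= /andP [zl]; rewrite !all_cat => /andP [_ d].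
rewrite (ltnW zl) /=; apply/andP; split; first by apply/allP => e /mapP [x _ ->].
by apply: sub_all (IH _ _ r d) => e /=; lia.
Qed.

(* Along a heap with decreasing edges, the number of cells pointing to the
   first node is its letter, and removing them leaves the heap of the tail. *)
Lemma reads_head k w l l' es :
  reads (k :: w) l l' es -> all (fun e => e.2 < e.1) es -> uniq (unzip1 es) ->
  exists z es1,
    [/\ (l, z) \in es, k = count (fun e => e.2 == l) es,
        es1 = [seq e <- es | (e.1 != l) && (e.2 != l)], subseq es1 es &
        reads w z l' es1].
Proof.
case=> z [ds [es1 [sz -> r]]] /= /andP [zl].
rewrite all_cat => /andP [_ d] /andP [nl _].
have tl : all (fun e => e.2 < l) es1.
  by apply: sub_all (reads_target_le r d) => e /=; lia.
exists z, es1; split=> //; first by rewrite inE eqxx.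
- rewrite (_ : (z == l) = false); last by lia.
  have cd : count (fun e => e.2 == l) [seq (x, l) | x <- ds] = k.
    by rewrite count_map -sz -[RHS]count_predT; apply: eq_count => x /=; rewrite eqxx.
  rewrite count_cat cd (_ : count _ es1 = 0) ?addn0 //.
  apply/eqP; rewrite -leqn0 leqNgt -has_count; apply/hasPn => e /(allP tl) /=; lia.
- rewrite /= eqxx /= filter_cat.
  rewrite (_ : [seq e <- _ | _] = [::]); last first.
    apply/eqP; rewrite -[_ == _]negbK -has_filter; apply/hasPn => e /mapP [x _ ->].
    by rewrite /= eqxx andbF.
  rewrite cat0s; apply/esym/all_filterP/allP => e ee.
  apply/andP; split; last by rewrite neq_ltn (allP tl e ee).
  apply/eqP => el; case/negP: nl; rewrite -el; apply: map_f.
  by rewrite mem_cat ee orbT.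
- apply: subseq_trans (suffix_subseq _ es1) (subseq_cons _ _).
Qed.

(** The letter and the remaining edges found by [reads_head] depend only on the multiset of edges,
    and distinct sources leave one possible successor of [l]; hence both readings agree letter by
    letter. *)
Lemma reads_inj w w' l l' es es' :
  reads w l l' es -> reads w' l l' es' -> perm_eq es es' ->
  all (fun e => e.2 < e.1) es -> uniq (unzip1 es) -> w = w'.
Proof.
elim: w w' l es es' => [|k w IH] [|k' w'] l es es' r r' pe d u //.
- case: r pe => _ ->; case: r' => z [ds [es1 [_ -> _]]].
  by move/perm_size.
- case: r' pe => _ ->; case: r => z [ds [es1 [_ -> _]]].
  by move/perm_size.
have d' : all (fun e => e.2 < e.1) es' by rewrite -(perm_all _ pe).
have u' : uniq (unzip1 es') by rewrite -(perm_uniq (perm_map _ pe)).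
have [z [es1 [zi -> e1 s1 r1]]] := reads_head r d u.
have [z' [es1' [zi' -> e1' s1' r1']]] := reads_head r' d' u'.
have zz : z = z'.
  move: zi'; rewrite -(perm_mem pe) => zi'.
  move/(nthP (0, 0)): zi => [i il ie].
  move/(nthP (0, 0)): zi' => [j jl je].
  have: nth 0 (unzip1 es) i = nth 0 (unzip1 es) j.
    by rewrite !(nth_map (0, 0)) // ie je.
  move/eqP; rewrite nth_uniq ?size_map // => /eqP ij.
  by move: je; rewrite -ij ie => -[].
rewrite -{}zz in r1'; rewrite (permP pe); congr (_ :: _).
apply: (IH w' z es1 es1') => //.
- by rewrite e1 e1'; apply: perm_filter.
- by rewrite e1 all_filter; apply: sub_all d => e /= ->; rewrite implybT.
- exact: subseq_uniq (map_subseq _ s1) u.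
Qed.

(** * Heaps given by lists of edges *)

(** Only the first selector is used, so any positive [nsel] will do. *)
Definition cell1 (nsel : nat) (hsel : 0 < nsel) (l : loc) : cell nsel :=
  [fmap].[Ordinal hsel <- l]%fmap.

Definition mkheap (nsel : nat) (hsel : 0 < nsel) (es : edges) : heap nsel :=
  foldr (fun e h => h.[e.1 <- cell1 hsel e.2]%fmap) [fmap]%fmap es.

Section Heaps.
Context (nsel : nat) (hsel : 0 < nsel).
Implicit Types (es : edges) (h : heap nsel).

Lemma cell1_fnd l (k : 'I_nsel) : (cell1 hsel l).[? k]%fmap = onth [:: l] k.
Proof.
rewrite fnd_set fnd_fmap0 -val_eqE /=.
by case: k => -[|[|k]] ik.
Qed.

Lemma cell1_inj : injective (cell1 hsel).
Proof.
move=> l l' e; have := cell1_fnd l (Ordinal hsel).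
by rewrite e cell1_fnd => -[].
Qed.

Lemma mem_mkheap es l : (l \in domf (mkheap hsel es)) = (l \in unzip1 es).
Proof. by elim: es => [|e es IH] //=; rewrite ?dom_setf ?inE ?IH. Qed.

Lemma mkheap_fnd es l l' :
  uniq (unzip1 es) ->
  ((mkheap hsel es).[? l]%fmap = Some (cell1 hsel l')) <-> (l, l') \in es.
Proof.
elim: es => [|[a b] es IH] /=; first by rewrite fnd_fmap0.
case/andP=> na u; rewrite fnd_set inE; case: (eqVneq l a) => [->|la].
  rewrite xpair_eqE eqxx /=; split=> [/Some_inj /cell1_inj <-|/orP [/eqP -> //|H]].
    by rewrite eqxx.
  by case/negP: na; apply: (map_f fst H).
by rewrite xpair_eqE (negbTE la) /=; apply: IH.
Qed.

Lemma mkheap_inj es es' :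
  uniq (unzip1 es) -> uniq (unzip1 es') -> mkheap hsel es = mkheap hsel es' ->
  perm_eq es es'.
Proof.
move=> u u' e; apply: uniq_perm; rewrite ?(map_uniq u) ?(map_uniq u') //.
by move=> [l l']; apply/idP/idP => /mkheap_fnd;
  rewrite ?e => /(_ ltac:(done)) H; apply/mkheap_fnd => //; rewrite ?e // -e.
Qed.

Lemma mkheap_cat es1 es2 :
  uniq (unzip1 (es1 ++ es2)) ->
  mkheap hsel (es1 ++ es2) = (mkheap hsel es1 + mkheap hsel es2)%fset.
Proof.
elim: es1 => [|[a b] es1 IH] /=.
  by move=> _; apply/fmapP => k; rewrite fnd_cat; case: fndP => //; rewrite fnd_fmap0.
case/andP; rewrite /unzip1 map_cat mem_cat => /norP [_ na] u.
rewrite IH ?/unzip1 ?map_cat //; apply/fmapP => k.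
rewrite fnd_cat !fnd_set fnd_cat mem_mkheap.
by case: (eqVneq k a) => // ->; rewrite (negbTE na).
Qed.

Lemma disjoint_mkheap es1 es2 :
  uniq (unzip1 es1) -> uniq (unzip1 es2) ->
  [disjoint domf (mkheap hsel es1) & domf (mkheap hsel es2)]%fset =
  uniq (unzip1 (es1 ++ es2)).
Proof.
move=> u1 u2; rewrite /unzip1 map_cat cat_uniq u1 u2 andbT /=.
apply/fdisjointP/hasPn => H x.
  move=> x2; apply/negP => x1.
  by have := H x; rewrite !mem_mkheap x1 x2 => /(_ isT).
by rewrite !mem_mkheap => x1; apply/negP => /H /negP.
Qed.

Definition is_heap es h := uniq (unzip1 es) /\ h = mkheap hsel es.

(** Sources are distinct in a concatenation when they are so in both parts and the domains are
    disjoint; separating conjunction thus becomes concatenation of edge lists. *)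
Lemma is_heap_cat es1 es2 h :
  is_heap (es1 ++ es2) h <->
  exists h1 h2 : heap nsel,
    [/\ [disjoint domf h1 & domf h2]%fset, h = (h1 + h2)%fset,
        is_heap es1 h1 & is_heap es2 h2].
Proof.
split=> [[u ->]|[h1 [h2 [d -> [u1 e1] [u2 e2]]]]].
  have /and3P [u1 _ u2] : [&& uniq (unzip1 es1),
      ~~ has (mem (unzip1 es1)) (unzip1 es2) & uniq (unzip1 es2)].
    by rewrite -cat_uniq -map_cat.
  exists (mkheap hsel es1), (mkheap hsel es2); split=> //.
    by rewrite disjoint_mkheap.
  exact: mkheap_cat.
move: d; rewrite e1 e2 disjoint_mkheap // => u.
by split=> //; rewrite mkheap_cat.
Qed.

Lemma is_heap_nil h : is_heap [::] h <-> domf h = fset0.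
Proof.
split=> [[_ ->]|h0]; first exact: domf0.
split=> //; apply/fmapP => k; rewrite fnd_fmap0; apply: not_fnd.
by have: k \notin domf h by rewrite h0 inE.
Qed.

Lemma sat_edge (s : store) h a b :
  sat s h (PointsTo a [:: b]) <->
  exists l l', [/\ s a = Some l, s b = Some l' & is_heap [:: (l, l')] h].
Proof.
split=> [[l [c [ls [sa]]]]|[l [l' [sa sb [_ ->]]]]].
  case: ls => [|l' [|//]] //= [sb] _ ck ->; exists l, l'; split=> //; split=> //=.
  congr (_.[_ <- _])%fmap; apply/fmapP => k.
  by rewrite ck cell1_fnd.
exists l, (cell1 hsel l'), [:: l']; split=> //=; first by rewrite sb.
exact: cell1_fnd.
Qed.

End Heaps.

(** * Unfoldings *)

Section InterpretedPredicates.
Context (nsel : nat) (I : nat -> seq loc -> heap nsel -> Prop).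

(** Interpreting predicate occurrences by [I] gives a meaning to the intermediate formulae of an
    unfolding. *)
Fixpoint satI (s : store) (h : heap nsel) (f : formula) : Prop :=
  match f with
  | Pred k us => exists2 ls, map s us = map Some ls & I k ls h
  | Star f g =>
      exists h1 h2 : heap nsel,
        [/\ [disjoint domf h1 & domf h2]%fset, h = (h1 + h2)%fset,
            satI s h1 f & satI s h2 g]
  | And f g => satI s h f /\ satI s h g
  | Ex x f => exists l, satI (upd s x l) h f
  | _ => sat s h f
  end.

End InterpretedPredicates.

Lemma satI_basic nsel I s (h : heap nsel) f : basic f -> satI I s h f <-> sat s h f.
Proof.
elim: f s h => //= [f IHf g IHg|f IHf g IHg|x f IH] s h.
- case/andP=> bf bg; split=> -[h1 [h2 [d e s1 s2]]]; exists h1, h2; split=> //;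
    by [apply/IHf|apply/IHg].
- by case/andP=> bf bg; split=> -[s1 s2]; split; by [apply/IHf|apply/IHg].
- by move=> bf; split=> -[l sl]; exists l; apply/IH.
Qed.

(** The unfolding is followed backwards: all connectives are monotone, so an [I] closed under the
    rules stays satisfied when a body is folded back into its predicate. *)
Lemma satI_sound nsel (I : nat -> seq loc -> heap nsel -> Prop) P :
  (forall k us d j r ws s h,
     onth P k = Some d -> onth (rules d) j = Some r ->
     size us = size (params d) -> size ws = size (exvars r) ->
     uniq ws -> ~~ has (mem us) ws ->
     satI I s h (body (params d) r us ws) -> satI I s h (Pred k us)) ->
  forall i us s h, sat_pred P s h i us -> satI I s h (Pred i us).
Proof.
move=> closed i us s h [f [uf bf] sf].
have {bf} {}sf : satI I s h f by apply/satI_basic.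
elim: uf s h sf => [f1 f2 r|//|f1 f2 f3 _ IH1 _ IH2] s h; last by move/IH2/IH1.
elim: r s h => {f f1 f2} [k vs d j r ws Pk rj su sw uw _ nw|f f' g _ IH|
  f g g' _ IH|f f' g _ IH|f g g' _ IH|x f f' _ IH] s h.
- exact: (closed k vs d j r ws).
- by case=> h1 [h2 [d e s1 s2]]; exists h1, h2; split=> //; apply: IH.
- by case=> h1 [h2 [d e s1 s2]]; exists h1, h2; split=> //; apply: IH.
- by case=> s1 s2; split=> //; apply: IH.
- by case=> s1 s2; split=> //; apply: IH.
- by case=> l sl; exists l; apply: IH.
Qed.

Lemma satI_exs nsel (I : nat -> seq loc -> heap nsel -> Prop) ws s h f :
  satI I s h (foldr Ex f ws) ->
  exists2 s' : store, (forall x, x \notin ws -> s' x = s x) & satI I s' h f.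
Proof.
elim: ws s => [|w ws IH] s /=; first by exists s.
case=> l /IH [s' e sf]; exists s' => // x; rewrite inE negb_or => /andP [xw xws].
by rewrite e // /upd /= (negbTE xw).
Qed.

Lemma sat_exs nsel (v : var -> loc) ws s (h : heap nsel) f :
  sat (fun x => if x \in ws then Some (v x) else s x) h f ->
  sat s h (foldr Ex f ws).
Proof.
elim: ws s => [|w ws IH] s //= sf; exists (v w); apply: IH.
congr (sat _ h f): sf; apply: functional_extensionality => x; rewrite /upd /=.
by rewrite inE; case: (x \in ws); rewrite ?orbT ?orbF //; case: eqP => // ->.
Qed.

Definition unfolds P := clos_refl_trans formula (replace P).

Lemma unfolds_map P (c : formula -> formula) :
  (forall f g, replace P f g -> replace P (c f) (c g)) ->
  forall f g, unfolds P f g -> unfolds P (c f) (c g).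
Proof.
move=> cr f g; elim=> [f1 f2 r|f1|f1 f2 f3 _ r1 _ r2].
- exact/rt_step/cr.
- exact: rt_refl.
- exact: rt_trans r1 r2.
Qed.

Lemma unfolds_star P f f' g g' :
  unfolds P f f' -> unfolds P g g' -> unfolds P (Star f g) (Star f' g').
Proof.
move=> rf rg; apply: rt_trans (_ : unfolds P (Star f' g) _).
  exact: (@unfolds_map P (Star ^~ g) (fun _ _ => @ReplaceStarL P _ _ _)).
exact: (@unfolds_map P (Star f') (fun _ _ => @ReplaceStarR P _ _ _)).
Qed.

Lemma unfolds_exs P ws f g :
  unfolds P f g -> unfolds P (foldr Ex f ws) (foldr Ex g ws).
Proof.
move=> r; elim: ws => //= w ws IH.
exact: (@unfolds_map P (Ex w) (fun _ _ => @ReplaceEx P _ _ _)).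
Qed.

Lemma basic_exs ws f : basic (foldr Ex f ws) = basic f.
Proof. by elim: ws. Qed.

Fixpoint sat_calls (nsel : nat) (P : system) (s : store) (h : heap nsel)
    (cs : seq (nat * seq var)) : Prop :=
  match cs with
  | [::] => domf h = fset0
  | c :: cs => exists h1 h2 : heap nsel,
      [/\ [disjoint domf h1 & domf h2]%fset, h = (h1 + h2)%fset,
          sat_pred P s h1 c.1 c.2 & sat_calls P s h2 cs]
  end.

Lemma sat_callsP nsel P s (h : heap nsel) cs :
  sat_calls P s h cs ->
  exists g, [/\ unfolds P (stars [seq Pred c.1 c.2 | c <- cs]) g, basic g & sat s h g].
Proof.
elim: cs h => [|c cs IH] h /=; first by exists Emp; split=> //; apply: rt_refl.
case=> h1 [h2 [d e [f [uf bf] sf] /IH [g [ug bg sg]]]].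
exists (Star f g); split; [exact: unfolds_star|by rewrite /= bf|].
by exists h1, h2.
Qed.

(** * From grammars to inductive systems *)

(* The node variables of the body of a rule calling [size As] predicates are
   [2 + size As, ..., 3, 2], in the order of the path; 2 is the second formal
   parameter, so that no case distinction on the last call is needed. *)
Fixpoint path_calls (As : seq nat) : seq (nat * seq var) :=
  match As with
  | [::] => [::]
  | A :: As => (A, [:: 3 + size As; 2 + size As]) :: path_calls As
  end.

(** The variables from [3 + size As] on are the cells pointing to the first parameter. The
    existential variables are listed downwards so that one more call prepends to the list, as the
    encoder needs. *)
Definition path_rule (k : nat) (As : seq nat) : rule :=
  Rule (rev (iota 3 (size As + k)))
    ((1, [:: 2 + size As]) :: [seq (i, [:: 1]) | i <- iota (3 + size As) k])
    (path_calls As) [::].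

Section Grammar.
Context (NT : eqType) (ns : seq NT) (rls : NT -> seq (nat * seq NT)).

(* Words derived from a stack of nonterminals, for a grammar whose productions
   [X -> k Bs] start with a terminal. *)
Fixpoint gen (st : seq NT) (w : seq nat) : Prop :=
  match w with
  | [::] => st = [::]
  | k :: w => exists X rest Bs,
      [/\ st = X :: rest, (k, Bs) \in rls X & gen (Bs ++ rest) w]
  end.

Lemma gen_cat s1 s2 w :
  gen (s1 ++ s2) w <->
  exists w1 w2, [/\ w = w1 ++ w2, gen s1 w1 & gen s2 w2].
Proof.
elim: w s1 => [|k w IH] s1 /=.
  split; first by case: s1 s2 => [|? ?] [|? ?] // _; exists [::], [::].
  by case=> -[|? ?] [[|? ?] []] //= _ -> ->.
split.
  case: s1 => [|X s1] /=; first by move=> H; exists [::], (k :: w).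
  case=> Y [rest [Bs [[<- <-] XB]]]; rewrite catA => /IH [w1 [w2 [-> g1 g2]]].
  by exists (k :: w1), w2; split=> //; exists X, s1, Bs.
case=> -[|k1 w1] [w2 [e g1 g2]]; first by move: g2; rewrite g1 -[w2]e.
case: e g1 => -> e [X [rest [Bs [-> XB g1]]]].
exists X, (rest ++ s2), Bs; split=> //; rewrite catA; apply/IH.
by exists w1, w2.
Qed.

Lemma gen_cons X rest k Bs w :
  (k, Bs) \in rls X -> gen (Bs ++ rest) w -> gen (X :: rest) (k :: w).
Proof. by move=> XB g; exists X, rest, Bs. Qed.

Definition path_predicate (X : NT) : predicate :=
  Predicate [:: 1; 2]
    [seq path_rule r.1 [seq index B ns | B <- r.2] | r <- rls X].

Definition path_system : system := map path_predicate ns.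

Context (ns_uniq : uniq ns).
Context (ns_closed :
  forall X k Bs, X \in ns -> (k, Bs) \in rls X -> all (mem ns) Bs).

(** * Predicates of the system and words of the grammar *)

Section Semantics.
Context (nsel : nat) (hsel : 0 < nsel).

Lemma sat_stars_edges (s : store) (h : heap nsel) vs a l :
  s a = Some l ->
  sat s h (stars [seq PointsTo w [:: a] | w <- vs]) <->
  exists2 ds, map s vs = map Some ds & is_heap hsel [seq (d, l) | d <- ds] h.
Proof.
move=> sa; elim: vs h => [|v vs IH] h /=.
  split=> [h0|[[|//] _ /is_heap_nil //]].
  by exists [::] => //; apply/is_heap_nil.
split.
  case=> h1 [h2 [d e /(sat_edge hsel) [x [y [sv sa' i1]]] /IH [ds sd i2]]].
  move: sa'; rewrite sa => -[ly]; exists (x :: ds); first by rewrite /= sv sd.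
  by apply/(@is_heap_cat _ _ [:: (x, l)]); exists h1, h2; split=> //; rewrite ly.
case=> -[|x ds] //= [sv sd] /(@is_heap_cat _ _ [:: (x, l)]) [h1 [h2 [d e i1 i2]]].
exists h1, h2; split=> //; last by apply/IH; exists ds.
by apply/(sat_edge hsel); exists x, l.
Qed.

Lemma basic_stars_edges a vs : basic (stars [seq PointsTo w [:: a] | w <- vs]).
Proof. by elim: vs. Qed.

Definition derives (A : nat) (ls : seq loc) (h : heap nsel) : Prop :=
  exists X l l' w es,
    [/\ X \in ns, A = index X ns & ls = [:: l; l']] /\
    [/\ gen [:: X] w, reads w l l' es & is_heap hsel es h].

Lemma path_calls_sound (s : store) sb (h : heap nsel) Bs l :
  all (mem ns) Bs -> s (sb (2 + size Bs)) = Some l ->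
  satI derives s h
    (stars [seq Pred c.1 (map sb c.2) |
            c <- path_calls [seq index B ns | B <- Bs]]) ->
  exists l' w es,
    [/\ s (sb 2) = Some l', gen Bs w, reads w l l' es & is_heap hsel es h].
Proof.
elim: Bs l h => [|B Bs IH] l h /=.
  by move=> _ sl h0; exists l, [::], [::]; split=> //; apply/is_heap_nil.
case/andP=> Bn Bsn sl [h1 [h2 [d e]]]; rewrite size_map.
case=> ls els [X [x [y [w [es [[Xn /esym iX els'] [g r i]]]]]]] sc.
move: els; rewrite els' /= => -[sx sy].
have {}sx : Some l = Some x by rewrite -sl -sx.
case: sx => lx; rewrite -{}lx in r.
have XB : X = B by apply: (index_inj B Xn Bn).
rewrite XB in g; have [l' [w2 [es2 [s2 g2 r2 i2]]]] := IH y h2 Bsn sy sc.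
exists l', (w ++ w2), (es ++ es2); split=> //.
- by apply/(@gen_cat [:: B]); exists w, w2.
- by apply/reads_cat; exists y, es, es2.
- by apply/is_heap_cat; exists h1, h2.
Qed.

Lemma onth_index X : X \in ns -> onth ns (index X ns) = Some X.
Proof. by move=> Xn; rewrite onthE (nth_map X) ?index_mem // nth_index. Qed.

Lemma path_system_onth A d :
  onth path_system A = Some d ->
  exists X, [/\ X \in ns, A = index X ns & d = path_predicate X].
Proof.
rewrite onth_map; case e: (onth ns A) => [X|] //= [<-]; exists X.
have Xn : X \in ns by apply/onthP; exists A.
have An : A < size ns by rewrite -onthTE e.
split=> //; apply/esym; rewrite -(onth_nth X _ _ _ e); exact: index_uniq.
Qed.

Lemma path_system_sound us (s : store) (h : heap nsel) A :
  sat_pred path_system s h A us -> satI derives s h (Pred A us).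
Proof.
apply: satI_sound => {us s h A} A us d j r ws s h /path_system_onth.
case=> X [Xn iX ->] /=; rewrite onth_map; case e: (onth _ j) => [[k Bs]|] //= [<-].
case: us => [|u1 [|u2 [|//]]] // _ sw uw nw.
have XB : (k, Bs) \in rls X by apply/onthP; exists j.
rewrite /body /=; set sb := inst _ _; move/satI_exs => [s' e']; rewrite size_map.
case=> h1 [h2 [d12 e12 [h3 [h4 [d34 e34 /(sat_edge hsel) [l [z [sl sz i3]]] sd]]] sc]].
have sb1 : sb 1 = u1 by [].
have sb2 : sb 2 = u2 by [].
have nws u : u \in [:: u1; u2] -> s' u = s u.
  by move=> ui; apply: e'; apply/negP => uw'; case/hasP: nw; exists u.
move: sd; rewrite -map_comp (eq_map (g := (fun w => PointsTo w [:: sb 1]) \o sb)) //.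
rewrite map_comp => /(satI_basic _ _ _ (basic_stars_edges _ _)).
case/(sat_stars_edges h4 _ sl) => ds dsE i4.
have sds : size ds = k by rewrite -(size_map Some) -dsE !size_map size_iota.
rewrite ?size_map in sz.
have [l' [w [es [s2 g rd i2]]]] :=
  @path_calls_sound s' sb h2 Bs z (ns_closed Xn XB) sz sc.
exists [:: l; l'].
  by rewrite /= -!nws ?inE ?eqxx ?orbT // -sb1 -sb2 sl s2.
exists X, l, l', (k :: w), ((l, z) :: [seq (d, l) | d <- ds] ++ es).
split; split=> //.
- by apply: gen_cons XB _; rewrite cats0.
- by exists z, ds, es.
- apply/(@is_heap_cat _ _ ((l, z) :: _)); exists h1, h2; split=> //.
  by apply/(@is_heap_cat _ _ [:: (l, z)]); exists h3, h4.
Qed.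

(* [path_split tau Bs es]: [es] is the concatenation of the edges of the calls
   of a rule, when [tau] gives the values of the node variables. *)
Fixpoint path_split (tau : nat -> loc) (Bs : seq NT) (w : seq nat) (es : edges) : Prop :=
  match Bs with
  | [::] => es = [::]
  | B :: Bs => exists w1 es1 w2 es2,
      [/\ w = w1 ++ w2, es = es1 ++ es2 & path_split tau Bs w2 es2] /\
      gen [:: B] w1 /\ reads w1 (tau (3 + size Bs)) (tau (2 + size Bs)) es1
  end.

Lemma eq_path_split tau tau' Bs w es :
  (forall v, 2 <= v <= 2 + size Bs -> tau v = tau' v) ->
  path_split tau Bs w es -> path_split tau' Bs w es.
Proof.
elim: Bs w es => //= B Bs IH w es tt [w1 [es1 [w2 [es2 [[ew ees p] [g r]]]]]].
exists w1, es1, w2, es2; split; last by split=> //; rewrite -!tt //; lia.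
by split=> //; apply: IH p => v lv; apply: tt; lia.
Qed.

Lemma path_split_exists Bs w l l' es :
  gen Bs w -> reads w l l' es ->
  exists tau, [/\ tau (2 + size Bs) = l, tau 2 = l' & path_split tau Bs w es].
Proof.
elim: Bs w l es => [|B Bs IH] w l es /=.
  by case: w => [_ [-> ->]|k w [X [rest [Bs []]]]] //; exists (fun=> l').
move=> /(@gen_cat [:: B]) [w1 [w2 [-> g1 g2]]] /reads_cat [z [e1 [e2 [-> r1 r2]]]].
have [tau [tz t2 p]] := IH _ _ _ g2 r2.
exists (fun v => if v == 3 + size Bs then l else tau v); split=> //.
  by rewrite eqxx.
exists w1, e1, w2, e2; split; split=> //.
  apply: eq_path_split p => v lv.
  by case: eqP => // ev; move: lv; rewrite ev; lia.
rewrite eqxx (_ : (_ == _) = false) ?tz //; lia.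
Qed.

(** The first premise is the induction hypothesis of [path_system_complete]; it applies because each
    call reads a part of [w]. *)
Lemma path_calls_complete n (s : store) sb tau (h : heap nsel) Bs w es :
  (forall X s (h : heap nsel) u1 u2 l l' w es, size w < n ->
     X \in ns -> gen [:: X] w -> reads w l l' es ->
     is_heap hsel es h -> s u1 = Some l -> s u2 = Some l' ->
     sat_pred path_system s h (index X ns) [:: u1; u2]) ->
  size w < n -> all (mem ns) Bs ->
  (forall v, 2 <= v <= 2 + size Bs -> s (sb v) = Some (tau v)) ->
  path_split tau Bs w es -> is_heap hsel es h ->
  sat_calls path_system s h
    [seq (c.1, map sb c.2) | c <- path_calls [seq index B ns | B <- Bs]].
Proof.
move=> IHn; elim: Bs w es h => [|B Bs IH] w es h wn /=.
  by move=> _ _ -> /is_heap_nil.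
case/andP=> Bn Bsn st [w1 [e1 [w2 [e2 [[ew -> p] [g r]]]]]].
move=> /is_heap_cat [h1 [h2 [d e i1 i2]]]; exists h1, h2; split=> //.
  rewrite size_map; apply: (IHn B _ _ _ _ _ _ w1 _ _ Bn g r i1); try by apply: st; lia.
  by move: wn; rewrite ew size_cat; lia.
apply: IH p i2 => //; first by move: wn; rewrite ew size_cat; lia.
by move=> v lv; apply: st; lia.
Qed.

Lemma path_system_complete X (s : store) (h : heap nsel) u1 u2 l l' w es :
  X \in ns -> gen [:: X] w -> reads w l l' es -> is_heap hsel es h ->
  s u1 = Some l -> s u2 = Some l' ->
  sat_pred path_system s h (index X ns) [:: u1; u2].
Proof.
have [n] := ubnP (size w).
elim: n X s h u1 u2 l l' w es => // n IHn X s h u1 u2 l l' [|k w] es /= wn Xn //.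
case=> _ [_ [Bs [[<- <-] XB]]]; rewrite cats0 => g.
case=> z [ds [es1 [sds ->]]] r /(@is_heap_cat _ _ ((l, z) :: _)).
case=> h1 [h2 [d12 e12 /(@is_heap_cat _ _ [:: (l, z)]) [h3 [h4 [d34 e34 i3 i4]]] i2]].
move=> su1 su2; have [tau0 [tz t2 p]] := path_split_exists g r.
pose m := size Bs.
(* Values of the body variables: 1 is the first node, 2 to [2 + m] are the later path nodes, and the
   rest are the cells pointing to the first node. *)
pose tau v := if v == 1 then l else if v < 3 + m then tau0 v else nth 0 ds (v - (3 + m)).
pose As := [seq index B ns | B <- Bs].
have sAs : size As = m by rewrite size_map.
pose xs := rev (iota 3 (m + k)).
(* Starting above [u1 + u2] keeps the bound variables apart from both arguments and from nil. *)
pose ws := iota (u1 + u2).+1 (m + k).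
pose v x := tau (nth 0 xs (index x ws)).
pose s' x := if x \in ws then Some (v x) else s x.
pose sb := inst ([:: 1; 2] ++ xs) ([:: u1; u2] ++ ws).
have szw : size ws = size xs by rewrite size_rev !size_iota.
have xsP x : (x \in xs) = (2 < x < 3 + (m + k)) by rewrite mem_rev mem_iota.
have s'1 : s' (sb 1) = Some (tau 1).
  by rewrite /s' /sb /inst /= mem_iota ltnNge leq_addr.
have s'2 : s' (sb 2) = Some (tau 2).
  by rewrite /s' /sb /inst /= mem_iota ltnNge leq_addl /= su2 /tau /= t2.
have s'x x : x \in xs -> s' (sb x) = Some (tau x).
  move=> xx; have := xx; rewrite xsP => /andP [x2 _].
  have -> : sb x = nth 0 ws (index x xs).
    by rewrite /sb /inst; case: x {xx} x2 => [|[|[|x]]].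
  have ix : index x xs < size ws by rewrite szw index_mem.
  by rewrite /s' mem_nth // /v index_uniq ?iota_uniq // nth_index.
have s'v x : 0 < x < 3 + (m + k) -> s' (sb x) = Some (tau x).
  case: x => [|[|[|x]]] // xlt; apply: s'x; rewrite xsP; lia.
have sc : sat_calls path_system s' h2 [seq (c.1, map sb c.2) | c <- path_calls As].
  apply: (path_calls_complete (tau := tau) IHn wn (ns_closed Xn XB) _ _ i2).
    by move=> x xl; apply: s'v; rewrite /m; lia.
  apply: eq_path_split p => x xl; rewrite /tau.
  have -> : (x == 1) = false by lia.
  by have -> : x < 3 + m by rewrite /m; lia.
have [f [uf bf sf]] := sat_callsP sc.
pose sg := PointsTo (sb 1) [:: sb (2 + m)] ::
  [seq PointsTo w [:: sb 1] | w <- map sb (iota (3 + m) k)].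
have [j jE] : exists j, onth (rls X) j = Some (k, Bs) by apply/onthP.
exists (foldr Ex (Star (stars sg) f) ws); last first.
  apply/(@sat_exs _ v); exists h1, h2; split=> //; exists h3, h4; split=> //.
    apply/(sat_edge hsel); exists l, z; split=> //.
    apply: etrans (s'v (2 + m) _) _; first by rewrite /m; lia.
    by rewrite /tau /= ltnS leqnn tz.
  apply/sat_stars_edges; first exact: s'1.
  exists ds => //; rewrite -map_comp -sds; apply: (@eq_from_nth _ None).
    by rewrite !size_map size_iota.
  move=> i; rewrite size_map size_iota => il.
  rewrite !(nth_map 0) ?size_iota // nth_iota //.
  apply: etrans (s'v (3 + m + i) _) _; first by lia.
  by rewrite /tau ltnNge leq_addr /= addKn.
split; last by rewrite basic_exs /= bf andbT; apply: basic_stars_edges.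
apply: rt_trans (_ : unfolds _ (body [:: 1; 2] (path_rule k As) [:: u1; u2] ws) _).
  apply: rt_step; apply: (@ReplacePred _ _ _ (path_predicate X) j) => //.
  - by rewrite onth_map onth_index.
  - by rewrite onth_map jE.
  - by rewrite szw /= sAs.
  - exact: iota_uniq.
  - by rewrite mem_iota.
  apply/hasPn => x; rewrite mem_iota !inE; lia.
rewrite /body [rpure _]/= [foldl _ _ _]/=; apply: unfolds_exs.
have -> : inst ([:: 1; 2] ++ exvars (path_rule k As)) ([:: u1; u2] ++ ws) = sb.
  by rewrite /= sAs.
apply: unfolds_star; last by move: uf; rewrite -map_comp.
by rewrite /sg /= sAs -!map_comp; apply: rt_refl.
Qed.
End Semantics.

(** Inclusion gives entailment by reusing the word read from the same heap. Conversely, the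
    canonical heap of a word of [X] is read as some word of [Y], and by [reads_inj] the two words
    coincide. *)
Lemma path_system_entails nsel (hsel : 0 < nsel) X Y :
  X \in ns -> Y \in ns ->
  entails nsel path_system (index X ns) (index Y ns) <->
  (forall w, gen [:: X] w -> gen [:: Y] w).
Proof.
move=> Xn Yn; have ar : arity path_system (index X ns) = Some 2.
  by rewrite /arity onth_map onth_index.
split=> [ent w g|sub us]; last first.
  rewrite ar => -[su] s h _ /(path_system_sound hsel).
  case: us su => [|u1 [|u2 [|//]]] // _ [ls els].
  case=> X' [l [l' [w [es [[X'n iX els'] [g r i]]]]]].
  have XX : X = X' by apply: (index_inj X Xn X'n).
  move: els; rewrite els' => -[s1 s2]; rewrite -{}XX in g.
  exact: path_system_complete Yn (sub _ g) r i s1 s2.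
have [es [l [n [r ln u d b]]]] := canonical_reading w.
(* Parameter 1 is the start of the path; parameter 2, like nil, is [null], where the canonical path
   ends. As edges decrease, [null] is never a source. *)
pose s : store := fun x => if x == 1 then Some l else Some null.
have sat1 : sat_pred path_system s (mkheap hsel es) (index X ns) [:: 1; 2].
  by apply: path_system_complete Xn g r _ _ _.
have st : is_state s (mkheap hsel es).
  split=> //.
    rewrite mem_mkheap; apply/mapP => -[e /(allP d) e21 e1].
    by move: e21; rewrite -e1.
  move=> x c; elim: (es) => [|e es' IH] /=; first by rewrite fnd_fmap0.
  rewrite fnd_set; case: eqP => [_ /Some_inj <-|_]; last exact: IH.
  by apply/fset0Pn; exists (Ordinal hsel); rewrite /cell1 dom_setf !inE eqxx.
have /(path_system_sound hsel) := ent [:: 1; 2] ar s _ st sat1.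
case=> ls els [Y' [y [y' [w' [es' [[Y'n iY els'] [g' r' [u' he]]]]]]]].
have YY : Y = Y' by apply: (index_inj X Yn Y'n).
move: els; rewrite els' => -[ly ly']; rewrite -{}YY in g'.
rewrite -{}ly -{}ly' in r'.
by rewrite (reads_inj r r' (mkheap_inj u u' he) d u).
Qed.

(** * Well-formedness and failure of connectedness *)

Lemma path_callsP As i c :
  onth (path_calls As) i = Some c ->
  exists2 A, onth As i = Some A &
    c = (A, [:: 2 + (size As - i); 1 + (size As - i)]).
Proof.
elim: As i => [|A As IH] [|i] //=; first by case=> <-; exists A.
by move/IH => [B eB ->]; exists B; rewrite ?subSS.
Qed.

Lemma eq_pure_nil x y : eq_pure [::] x y -> x = y.
Proof.
move=> e; apply/eqP; apply/idP; apply: contraT => xy.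
(* This store separates [y] from every other variable while keeping nil at [null]. *)
have := e (fun v => if v == nilv then Some null else if v == y then Some 1 else Some 2).
rewrite eqxx (negbTE xy) => /(_ erefl (fun _ _ => ltac:(done))) /=.
case: (eqVneq y nilv) xy => [->|yn] xy; first by rewrite (negbTE xy).
by rewrite eqxx; case: ifP.
Qed.

Lemma path_system_wf :
  (forall X, X \in ns -> rls X != [::]) -> wf_system path_system.
Proof.
move=> rn i d /path_system_onth [X [Xn _ ->]] /=; split.
  by rewrite size_map lt0n size_eq0 rn.
move=> j r; rewrite onth_map; case e: (onth _ j) => [[k Bs]|] //= [<-].
have XB : (k, Bs) \in rls X by apply/onthP; exists j.
have Bn := ns_closed Xn XB; set As := map _ _.
have sA : size As = size Bs by rewrite size_map.
have xsP x : (x \in [:: 1; 2] ++ rev (iota 3 (size As + k))) = (0 < x < 3 + size As + k).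
  by rewrite mem_cat mem_rev mem_iota !inE; lia.
split.
- split; last by rewrite xsP.
  rewrite cat_uniq rev_uniq iota_uniq andbT /=.
  by apply/hasPn => x; rewrite mem_rev mem_iota !inE; lia.
- split=> //; first by apply/allP => a; rewrite inE => /orP [/eqP ->|/mapP [x _ ->]].
  move=> x; rewrite xsP /fv_spatial /= !inE.
  case/or3P=> [/eqP ->|/eqP ->|/flattenP [ys /mapP [a /mapP [y]]]]; try lia.
  by rewrite mem_iota => yi -> -> /=; rewrite !inE => /orP [/eqP ->|/eqP ->]; lia.
- move=> c /onthP [n /path_callsP [A nA ->]] /=.
  have nl : n < size As by rewrite -onthTE nA.
  split; last by move=> x; rewrite xsP !inE => /orP [/eqP ->|/eqP ->]; lia.
  move: nA; rewrite onth_map; case eB: (onth Bs n) => [B|] //= [<-].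
  exists (path_predicate B) => //; rewrite onth_map onth_index //.
  by apply: (allP Bn); apply/onthP; exists n.
- by [].
- split; first by move=> b y _ yb /eq_pure_nil yb'; rewrite yb' eqxx in yb.
  (* Of the two parameters only 2 is passed, and only to the last call. *)
  move=> n1 n2 c1 c2 x y /path_callsP [A1 o1 ->] /path_callsP [A2 o2 ->].
  have nl1 : n1 < size As by rewrite -onthTE o1.
  have nl2 : n2 < size As by rewrite -onthTE o2.
  by rewrite !inE /= => ? ? ? ? _; lia.
Qed.

(** A positive letter yields a cell pointing to the first parameter; no edge enters that cell, so no
    parameter reaches it. *)
Lemma path_system_not_connected X k Bs :
  X \in ns -> (k.+1, Bs) \in rls X -> ~ connected_system path_system.
Proof.
move=> Xn XB conn; have /onthP [j jE] := XB.
have Po : onth path_system (index X ns) = Some (path_predicate X).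
  by rewrite onth_map onth_index.
have := conn _ _ j (path_rule k.+1 [seq index B ns | B <- Bs]) Po.
rewrite onth_map jE => /(_ erefl).
case=> x [x12 rt _]; pose m := size Bs.
have := rt (3 + m); rewrite /fv_spatial /= size_map -/m => /(_ _) rch.
pose sg := (1, [:: 2 + m]) :: [seq (i, [:: 1]) | i <- iota (3 + m) k.+1].
have {rch} : reachable sg [::] x (3 + m).
  by apply: rch; rewrite !inE eqxx !orbT.
(* Variables below [3 + m] are closed under edges: among them only 1 is a source, and it points to
   [2 + m]. *)
have inv a b : reachable sg [::] a b -> a < 3 + m -> b < 3 + m.
  elim=> {a b} [a b /eq_pure_nil -> //|a a' bs b y /eq_pure_nil ->].
  rewrite inE => /orP [/eqP [-> ->]|/mapP [z]].
    by rewrite inE => /eqP -> _ IH _; apply: IH; lia.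
  by rewrite mem_iota => zi [-> ->] _ _ _; lia.
move/inv; rewrite ltnn => /(_ _)/negP; apply; move: x12; rewrite !inE; lia.
Qed.

End Grammar.

(** * The grammar of counter traces *)

Definition halts (p : program) (x : nat) : Prop :=
  exists n, size p <= (iter n (step p) (init x)).1.

(* The letter 0 acts on no counter. *)
Definition incl r := 3 * r + 1.
Definition decl r := 3 * r + 2.
Definition tstl r := 3 * r + 3.

(** [None] marks an error of counter [r]: a decrement at zero, or a zero test passed while
    positive. *)
Definition act (r k n : nat) : option nat :=
  if k == incl r then Some n.+1
  else if k == decl r then if n is m.+1 then Some m else None
  else if k == tstl r then if n is 0 then Some 0 else None
  else Some n.

Fixpoint run (r : nat) (w : seq nat) (n : nat) : option nat :=
  if w is k :: w then obind (run r w) (act r k n) else Some n.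

Section Traces.
Context (p : program) (nr x : nat).

Definition nt := (nat * nat)%type.
Notation start := ((0, 0) : nt).
Notation bad := ((1, 0) : nt).
Notation anyw := ((2, 0) : nt).
Notation tick := ((3, 0) : nt).
Notation "'at_' pc" := ((4, pc) : nt) (at level 10).
Notation down r := ((5, r) : nt).
Notation decerr r := ((6, r) : nt).
Notation tsterr r := ((7, r) : nt).
Notation above r := ((8, r) : nt).

Definition letters : seq nat := iota 0 (3 * nr + 1).
Definition others r := [seq k <- letters | (k != incl r) && (k != decl r)].
(** Jumps out of the program are clipped to [size p], where [prods] emits the final 0, so that
    finitely many nonterminals suffice. *)
Definition target pc : nt := at_ (minn pc (size p)).

(** [bad] guesses a counter and a kind of error. [down r] derives the words along which counter [r]
    first falls one below its starting level, as far as increments and decrements count. An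
    increment is guessed to be undone later, which puts [down r] on the stack, or to remain until a
    failing zero test, which leads to [above r]. After the error, [anyw] derives any nonempty
    rest. *)
Definition prods (X : nt) : seq (nat * seq nt) :=
  let: (t, r) := X in
  match t with
  | 0 => [:: (0, nseq x tick ++ [:: at_ 0])]
  | 1 => [seq (0, [:: (t, r)]) | t <- [:: 6; 7], r <- iota 0 nr]
  | 2 => [seq (k, [::]) | k <- letters] ++ [seq (k, [:: anyw]) | k <- letters]
  | 3 => [:: (incl 0, [::])]
  | 4 => match onth p r with
         | None => [:: (0, [::])]
         | Some (Inc i) => [:: (incl i, [:: target r.+1])]
         | Some (Dec i j) => [:: (decl i, [:: target r.+1]); (tstl i, [:: target j])]
         end
  | 5 => (decl r, [::]) :: (incl r, [:: down r; down r]) ::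
         [seq (k, [:: down r]) | k <- others r]
  | 6 => (decl r, [:: anyw]) :: (incl r, [:: down r; decerr r]) ::
         [seq (k, [:: decerr r]) | k <- others r]
  | 7 => (incl r, [:: above r]) :: (incl r, [:: down r; tsterr r]) ::
         [seq (k, [:: tsterr r]) | k <- others r]
  | _ => (tstl r, [:: anyw]) :: (incl r, [:: above r]) ::
         (incl r, [:: down r; above r]) ::
         [seq (k, [:: above r]) | k <- others r]
  end.

Local Notation gen := (gen prods).

Lemma act_inc r n : act r (incl r) n = Some n.+1.
Proof. by rewrite /act eqxx. Qed.

Lemma act_dec r n : act r (decl r) n = if n is m.+1 then Some m else None.
Proof.
rewrite /act eqxx.
by have -> : (decl r == incl r) = false by rewrite /incl /decl; lia. Qed.

Lemma act_tst r n : act r (tstl r) n = if n is 0 then Some 0 else None.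
Proof.
rewrite /act eqxx.
have -> : (tstl r == incl r) = false by rewrite /incl /tstl; lia.
by have -> : (tstl r == decl r) = false by rewrite /decl /tstl; lia.
Qed.

Lemma act_neq i r k n :
  i != r -> k \in [:: incl r; decl r; tstl r] -> act i k n = Some n.
Proof.
move=> ir; rewrite !inE => kr; rewrite /act.
have -> : (k == incl i) = false by move: kr; rewrite /incl /decl /tstl; lia.
have -> : (k == decl i) = false by move: kr; rewrite /incl /decl /tstl; lia.
by have -> : (k == tstl i) = false by move: kr; rewrite /incl /decl /tstl; lia.
Qed.

Lemma act_others r k n : k \in others r ->
  act r k n = if (k == tstl r) && (0 < n) then None else Some n.
Proof.
rewrite mem_filter => /andP [/andP [ki kd] _].
by rewrite /act (negbTE ki) (negbTE kd); case: eqP => // _; case: n.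
Qed.

Lemma gen_anyw w : all (mem letters) w -> w != [::] -> gen [:: anyw] w.
Proof.
elim: w => [|k [|k' w] IH] //= /andP [kl wl] _.
  by exists anyw, [::], [::]; split=> //; rewrite mem_cat map_f.
exists anyw, [::], [:: anyw]; split=> //; last exact: IH.
by rewrite mem_cat (map_f (fun k => (k, [:: anyw]))) ?orbT.
Qed.

(* A stack [nseq n (down r) ++ [:: Z]] tracks that the counter [r] is [n] above
   the level at which [Z] started. *)
Definition level_ok (t n m : nat) :=
  ((t == 6) || (t == 7)) && (m == n) || (t == 8) && (n < m).

(** The stack follows the counter letter by letter, and [anyw], the only way to get rid of the
    bottom symbol, comes after a letter on which the counter fails. *)
Lemma gen_error r t n m w :
  level_ok t n m -> gen (nseq n (down r) ++ [:: (t, r)]) w -> run r w m = None.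
Proof.
elim: w t n m => [|k w IH] t n m lv /=; first by case: n {lv}.
case: n lv => [|n] lv [X [rest [Bs [/= [<- <-]]]]].
  rewrite cats0; case/orP: (lv) => [/andP [/orP [/eqP t6|/eqP t7] /eqP ->]|].
  - rewrite t6 /= !inE => /or3P [/eqP [-> ->] _|/eqP [-> ->] g|].
    + by rewrite act_dec.
    + by rewrite act_inc /=; apply: (IH 6 1 1) g.
    case/mapP=> k' ko [-> ->] g; rewrite act_others // andbF /=.
    exact: (IH 6 0 0) g.
  - rewrite t7 /= !inE => /or3P [/eqP [-> ->] g|/eqP [-> ->] g|].
    + by rewrite act_inc /=; apply: (IH 8 0 1) g.
    + by rewrite act_inc /=; apply: (IH 7 1 1) g.
    case/mapP=> k' ko [-> ->] g; rewrite act_others // andbF /=.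
    exact: (IH 7 0 0) g.
  case/andP=> /eqP -> m0 /=; rewrite !inE.
  case/or4P=> [/eqP [-> ->] _|/eqP [-> ->] g|/eqP [-> ->] g|].
  - by rewrite act_tst; case: m m0 {lv}.
  - by rewrite act_inc /=; apply: (IH 8 0 m.+1) g.
  - by rewrite act_inc /=; apply: (IH 8 1 m.+1) g.
  case/mapP=> k' ko [-> ->] g; rewrite act_others // m0; case: ifP => //= _.
  exact: (IH 8 0 m) g.
have m0 : 0 < m by move: lv; rewrite /level_ok; lia.
rewrite /= !inE => /or3P [/eqP [-> ->] g|/eqP [-> ->] g|].
- rewrite act_dec; case: m m0 lv => // m _ lv /=; apply: IH g.
  by move: lv; rewrite /level_ok; lia.
- rewrite act_inc /=; apply: (IH t n.+2) g.
  by move: lv; rewrite /level_ok; lia.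
case/mapP=> k' ko [-> ->] g; rewrite act_others //; case: ifP => //= _.
exact: (IH t n.+1) g.
Qed.

(** The added [down r] promises that this increment is undone; [down r] and the three bottom symbols
    all have such a production. *)
Lemma gen_inc r t n w : 6 <= t <= 8 ->
  gen (nseq n.+1 (down r) ++ [:: (t, r)]) w ->
  gen (nseq n (down r) ++ [:: (t, r)]) (incl r :: w).
Proof.
case: n => [|n] tt g; last first.
  by apply: (gen_cons (Bs := [:: down r; down r])) g; rewrite /= !inE eqxx orbT.
apply: (gen_cons (Bs := [:: down r; (t, r)])) g.
by case: t tt => [|[|[|[|[|[|[|[|[|]]]]]]]]] //= _; rewrite !inE eqxx !orbT.
Qed.

Lemma gen_others r t n k w : 6 <= t <= 8 -> k \in others r ->
  gen (nseq n (down r) ++ [:: (t, r)]) w ->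
  gen (nseq n (down r) ++ [:: (t, r)]) (k :: w).
Proof.
move=> tt ko; case: n => [|n] g; last first.
  apply: (gen_cons (Bs := [:: down r])) g.
  by rewrite /= !inE (map_f (fun k => (k, [:: down r]))) ?orbT.
apply: (gen_cons (Bs := [:: (t, r)])) g.
have := map_f (fun k => (k, [:: (t, r)])) ko.
by case: t tt => [|[|[|[|[|[|[|[|[|]]]]]]]]] //= _ H; rewrite !inE H !orbT.
Qed.

(** The stack is reconstructed backwards from the first error. *)
Lemma error_gen r w n :
  r < nr -> all (mem letters) w -> last 0 w = 0 -> run r w n = None ->
  exists t m, [/\ 6 <= t <= 8, level_ok t m n &
                  gen (nseq m (down r) ++ [:: (t, r)]) w].
Proof.
move=> rn; elim: w n => [|k w IH] n //= /andP [kl wl] lw.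
(* Error letters are not 0 but the last letter is, so a nonempty rest is left for [anyw]. *)
have wn : k != 0 -> w != [::] by case: (w) lw => //= -> /eqP.
have lw0 : last 0 w = 0 by case: (w) lw.
case: (eqVneq k (incl r)) => [->|ki].
  rewrite act_inc /= => /(IH _ wl lw0) [t [m [tt lv g]]].
  case: m lv g => [|m] lv g; last first.
    by exists t, m; split=> //; apply: gen_inc.
  (* No [down r] accounts for this increment, so it remains until the failing test: the bottom
     symbol is [above r], reached from [tsterr r] if the counter was zero and from itself
     otherwise. *)
  have t8 : t = 8 by move: lv; rewrite /level_ok; lia.
  rewrite t8 /= in g; case: n {lv} => [|n].
    exists 7, 0; split=> //.
    by apply: (gen_cons (Bs := [:: above r])) g; rewrite !inE eqxx.
  exists 8, 0; split=> //.
  by apply: (gen_cons (Bs := [:: above r])) g; rewrite !inE eqxx ?orbT.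
case: (eqVneq k (decl r)) => [kd|kd].
  have w0 : w != [::] by apply: wn; rewrite kd /decl; lia.
  rewrite kd act_dec; case: n => [|n] /=.
    move=> _; exists 6, 0; split=> //.
    apply: (gen_cons (Bs := [:: anyw])); first by rewrite !inE eqxx.
    by rewrite cats0; apply: gen_anyw.
  case/(IH _ wl lw0) => t [m [tt lv g]]; exists t, m.+1; split=> //.
  by apply: (gen_cons (Bs := [::])) g; rewrite !inE eqxx.
have ko : k \in others r by rewrite mem_filter ki kd.
rewrite act_others //; case: ifP => [/andP [/eqP kt n0] _|_] /=.
  exists 8, 0; split=> //; apply: (gen_cons (Bs := [:: anyw])).
    by rewrite kt !inE eqxx.
  by rewrite cats0; apply: gen_anyw => //; apply: wn; rewrite kt /tstl; lia.
case/(IH _ wl lw0) => t [m [tt lv g]]; exists t, m; split=> //.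
exact: gen_others.
Qed.

(** * Traces following the control flow *)

Definition instr_reg (i : instr) : nat :=
  match i with Inc r => r | Dec r _ => r end.

Context (regs_lt : forall i a, onth p i = Some a -> instr_reg a < nr).

Lemma prods_target pc :
  prods (target pc) =
  match onth p pc with
  | None => [:: (0, [::])]
  | Some (Inc i) => [:: (incl i, [:: target pc.+1])]
  | Some (Dec i j) => [:: (decl i, [:: target pc.+1]); (tstl i, [:: target j])]
  end.
Proof.
rewrite /target /=; case: (leqP pc (size p)) => [//|l].
by rewrite !onth_default // ltnW.
Qed.

(* The default value 1 makes the equation on [last] express that [w] is also
   nonempty. *)
Lemma trace_letters pc w :
  gen [:: target pc] w -> all (mem letters) w /\ last 1 w = 0.
Proof.
have lk k u : last 1 u = 0 -> last k u = 0 by case: u.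
elim: w pc => [|k w IH] pc //= [X [rest [Bs [[<- <-]]]]].
rewrite prods_target /letters; case e: (onth p pc) => [[r|r j]|] /=.
- have /= rl := regs_lt e; rewrite inE => /eqP [-> ->] /IH [-> /lk ->].
  by rewrite mem_iota /incl; split=> //; rewrite andbT; lia.
- have /= rl := regs_lt e; rewrite !inE => /orP [] /eqP [-> ->] /IH [-> /lk ->].
    by rewrite mem_iota /decl; split=> //; rewrite andbT; lia.
  by rewrite mem_iota /tstl; split=> //; rewrite andbT; lia.
- rewrite inE => /eqP [-> ->]; case: w {IH} => [|k' w] /=.
    by rewrite mem_iota; split=> //; lia.
  by case=> [? [? [? []]]].
Qed.

(** A decrement or zero test accepted by its own counter determines the branch taken, so an
    error-free word is the actual run. *)
Lemma trace_halts pc w (R : nat -> nat) :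
  gen [:: target pc] w -> (forall r, r < nr -> run r w (R r) <> None) ->
  exists n, size p <= (iter n (step p) (pc, R)).1.
Proof.
elim: w pc R => [|k w IH] pc R //= [X [rest [Bs [[<- <-]]]]].
rewrite prods_target; case e: (onth p pc) => [[r|r j]|] /=; last first.
- by move=> _ _ _; exists 0; rewrite /= leqNgt -onthTE e.
- have rl := regs_lt e; rewrite !inE => /orP [] /eqP [-> ->] g ok.
    have [m Rm] : exists m, R r = m.+1.
      by have := ok _ rl; rewrite act_dec; case: (R r) => // m _; exists m.
    case: (IH _ (set_reg R r m) g) => [i il|n hn].
      have := ok _ il; rewrite /set_reg /=; case: eqP => [->|/eqP ir].
        by rewrite act_dec Rm.
      by rewrite (act_neq _ ir) ?inE ?eqxx ?orbT.
    by exists n.+1; rewrite iterSr /= e Rm.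
  have R0 : R r = 0.
    by have := ok _ rl; rewrite act_tst; case: (R r).
  case: (IH _ R g) => [i il|n hn].
    have := ok _ il; case: (eqVneq i r) => [->|ir].
      by rewrite act_tst R0.
    by rewrite (act_neq _ ir) ?inE ?eqxx ?orbT.
  by exists n.+1; rewrite iterSr /= e R0.
have rl := regs_lt e; rewrite !inE => /eqP [-> ->] g ok.
case: (IH _ (set_reg R r (R r).+1) g) => [i il|n hn].
  have := ok _ il; rewrite /set_reg /=; case: eqP => [->|/eqP ir].
    by rewrite act_inc.
  by rewrite (act_neq _ ir) ?inE ?eqxx ?orbT.
by exists n.+1; rewrite iterSr /= e.
Qed.

Lemma halts_trace n pc (R : nat -> nat) :
  size p <= (iter n (step p) (pc, R)).1 ->
  exists2 w, gen [:: target pc] w & forall r, run r w (R r) <> None.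
Proof.
have halted q S : size p <= q ->
    exists2 w, gen [:: target q] w & forall r, run r w (S r) <> None.
  move=> pq; exists [:: 0].
    by exists (target q), [::], [::]; rewrite prods_target onth_default.
  move=> r /=; rewrite /act (_ : 0 == incl r = false) /incl ?addn1 //.
  by rewrite /decl /tstl addn2 addn3.
elim: n pc R => [|n IH] pc R; first exact: halted.
rewrite iterSr /=; case e: (onth p pc) => [[r|r j]|]; last exact: IH.
- move=> /IH [w g ok]; exists (incl r :: w).
    apply: (gen_cons (Bs := [:: target pc.+1])) g.
    by rewrite prods_target e inE.
  move=> i /=; case: (eqVneq i r) => [->|ir].
    by have := ok r; rewrite act_inc /set_reg /= eqxx.
  by have := ok i; rewrite (act_neq _ ir) ?inE ?eqxx // /set_reg /= (negbTE ir).
- case Rr: (R r) => [|m] /IH [w g ok].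
    exists (tstl r :: w).
      apply: (gen_cons (Bs := [:: target j])) g.
      by rewrite prods_target e !inE eqxx orbT.
    move=> i /=; case: (eqVneq i r) => [->|ir].
      by have := ok r; rewrite act_tst Rr.
    by have := ok i; rewrite (act_neq _ ir) ?inE ?eqxx ?orbT.
  exists (decl r :: w).
    apply: (gen_cons (Bs := [:: target pc.+1])) g.
    by rewrite prods_target e !inE eqxx.
  move=> i /=; case: (eqVneq i r) => [->|ir].
    by have := ok r; rewrite act_dec Rr /set_reg /= eqxx.
  by have := ok i; rewrite (act_neq _ ir) ?inE ?eqxx ?orbT // /set_reg /= (negbTE ir).
Qed.

Lemma gen_ticks m st w :
  gen (nseq m tick ++ st) w <->
  exists2 w', w = nseq m (incl 0) ++ w' & gen st w'.
Proof.
elim: m w => [|m IH] w /=; first by split=> [g|[w' ->]] //; exists w.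
split.
  case: w => [|k w] // [X [rest [Bs [[<- <-]]]]]; rewrite inE => /eqP [-> ->].
  by move/IH => [w' -> g]; exists w'.
case=> w' -> g; exists tick, (nseq m tick ++ st), [::]; split=> //.
by apply/IH; exists w'.
Qed.

Lemma run_ticks m w r n :
  run r (nseq m (incl 0) ++ w) n = run r w (if r == 0 then n + m else n).
Proof.
elim: m n => [|m IH] n /=; first by rewrite addn0; case: ifP.
case: (eqVneq r 0) IH => [->|r0] IH.
  by rewrite act_inc /= IH addSnnS.
by rewrite (act_neq _ r0) ?inE ?eqxx //= IH.
Qed.

Lemma start_gen w :
  gen [:: start] w <->
  exists2 w', w = 0 :: nseq x (incl 0) ++ w' & gen [:: target 0] w'.
Proof.
rewrite -[target 0]/(at_ (minn 0 (size p))) min0n.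
split=> [|[w' -> g]].
  case: w => [|k w] // [X [rest [Bs [[<- <-]]]]]; rewrite inE => /eqP [-> ->].
  by rewrite cats0 => /gen_ticks [w' -> g]; exists w'.
apply: (gen_cons (Bs := nseq x tick ++ [:: at_ 0])); first by rewrite inE.
by rewrite cats0; apply/gen_ticks; exists w'.
Qed.

Lemma bad_gen w :
  gen [:: bad] w <->
  exists t r w', [/\ w = 0 :: w', t \in [:: 6; 7], r < nr & gen [:: (t, r)] w'].
Proof.
split=> [|[t [r [w' [-> tt rn g]]]]].
  case: w => [|k w] // [X [rest [Bs [[<- <-]]]]].
  case/allpairsP => [[t r] [tt]]; rewrite mem_iota => /andP [_ rn] [-> ->] g.
  by exists t, r, w.
apply: (gen_cons (Bs := [:: (t, r)])) g; apply/allpairsP.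
by exists (t, r); rewrite mem_iota.
Qed.

(** The error-free trace of a halting run is kept out of [bad] by [gen_error]. Without halting,
    every trace has an error by [trace_halts], and [error_gen] derives it. *)
Lemma traces_included :
  (forall w, gen [:: start] w -> gen [:: bad] w) <-> ~ halts p x.
Proof.
split=> [sub [n /halts_trace [w g ok]]|nh w /start_gen [w' -> g]].
  have /sub /bad_gen : gen [:: start] (0 :: nseq x (incl 0) ++ w).
    by apply/start_gen; exists w.
  case=> t [r [w' [[<-] tt rn /(@gen_error _ t 0 0) err]]].
  have okr : run r w (if r == 0 then 0 + x else 0) <> None := ok r.
  apply: okr; rewrite -run_ticks; apply: err.
  by move: tt; rewrite !inE /level_ok => ->.
have [al lw] := trace_letters g.
pose w1 := nseq x (incl 0) ++ w'.
have [r rn err] : exists2 r, r < nr & run r w1 0 = None.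
  (* The failing counter is found by a finite search. *)
  have [/hasP [r]|/hasPn nerr] := boolP (has (fun r => run r w1 0 == None) (iota 0 nr)).
    by rewrite mem_iota => rn /eqP err; exists r.
  case: nh; apply: trace_halts g _ => r rn.
  have := nerr r; rewrite mem_iota rn run_ticks => /(_ isT) /eqP.
  by rewrite add0n.
apply/bad_gen.
have : all (mem letters) w1 /\ last 0 w1 = 0.
  split.
    rewrite all_cat al andbT; apply/allP => k /nseqP [-> _].
    by rewrite /= mem_iota /incl; lia.
  by rewrite last_cat; case: (w') lw.
(* At counter value 0, [level_ok] allows no [down r] and excludes [above r], so [bad] can guess this
   error. *)
case=> al1 /(error_gen rn al1) /(_ err) [t [[|m] [tt lv g']]].
  exists t, r, w1; split=> //.
  by move: lv; rewrite /level_ok ltnn andbF orbF eqxx andbT !inE.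
by move: lv; rewrite /level_ok andbF /= ltn0 andbF.
Qed.


(** The order matters: [start] and [bad] get the indices 0 and 1 of the instance, and [start], whose
    production alone mentions the input, comes first. *)
Definition nts : seq nt :=
  [:: start; bad; anyw; tick] ++
  [seq at_ pc | pc <- iota 0 (size p).+1] ++
  [seq (t, r) | t <- [:: 5; 6; 7; 8], r <- iota 0 nr].

Lemma uniq_nts : uniq nts.
Proof.
have ins (t pc : nat) : ((t, pc) \in [seq at_ pc | pc <- iota 0 (size p).+1]) -> t = 4.
  by case/mapP => ? _ [].
have inr (t r : nat) :
    ((t, r) \in [seq (t, r) | t <- [:: 5; 6; 7; 8], r <- iota 0 nr]) -> 4 < t.
  by case/allpairsP => -[a b] [/= ta _ [-> _]]; move: ta; rewrite !inE; lia.
rewrite cat_uniq; apply/and3P; split=> //.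
  apply/hasPn => -[t r]; rewrite mem_cat => /orP tr.
  have t4 : 3 < t by case: tr => [/ins ->|/inr /ltnW].
  by rewrite /= !inE !xpair_eqE; lia.
rewrite cat_uniq; apply/and3P; split.
- by rewrite map_inj_uniq ?iota_uniq // => a b [].
- by apply/hasPn => -[t r] /inr t4; apply/negP => /ins t4'; rewrite t4' in t4.
apply: allpairs_uniq => //; first exact: iota_uniq.
by move=> [a b] [c d] _ _.
Qed.

Lemma target_nts pc : target pc \in nts.
Proof.
rewrite !mem_cat (map_f (fun pc => at_ pc)) ?orbT // mem_iota /=.
by rewrite ltnS geq_minr.
Qed.

Lemma counter_nts t r : t \in [:: 5; 6; 7; 8] -> r < nr -> (t, r) \in nts.
Proof.
move=> tt rn; rewrite /nts mem_cat; apply/orP; right; rewrite mem_cat.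
apply/orP; right; apply/allpairsP.
by exists (t, r); rewrite mem_iota.
Qed.

Lemma prods_nts X k Bs :
  X \in nts -> (k, Bs) \in prods X -> all (mem nts) Bs.
Proof.
have oth r Y : Y \in nts -> (k, Bs) \in [seq (k, [:: Y]) | k <- others r] ->
    all (mem nts) Bs.
  by move=> Yn /mapP [k' _ [_ ->]] /=; rewrite Yn.
have an : anyw \in nts by [].
rewrite /nts mem_cat => /orP [|].
  rewrite !inE => /or4P [] /eqP ->.
  - rewrite /= inE => /eqP [_ ->]; apply/allP => Y; rewrite mem_cat inE.
    case/orP=> [/nseqP [-> _] //|/eqP ->].
    by have := target_nts 0; rewrite /target min0n.
  - case/allpairsP => -[t r] [tt]; rewrite mem_iota => /andP [_ rn] [_ ->].
    by rewrite /= counter_nts //; move: tt; rewrite !inE /= => /orP [] ->; rewrite ?orbT.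
  - by rewrite /= mem_cat => /orP [] /mapP [k' _ [_ ->]].
  - by rewrite /= inE => /eqP [_ ->].
rewrite mem_cat => /orP [/mapP [pc pcn ->]|/allpairsP [[t r] [tt rn ->]]].
  rewrite /=; case: (onth p pc) => [[i|i j]|]; rewrite !inE.
  - by case/eqP => _ ->; rewrite /= target_nts.
  - by case/orP => /eqP [_ ->]; rewrite /= target_nts.
  - by case/eqP => _ ->.
have {}rn : r < nr by move: rn; rewrite mem_iota => /andP [].
have cn := fun t tt => @counter_nts t r tt rn.
move: tt; rewrite !inE => /or4P [] /eqP -> /=; rewrite !inE.
- case/or3P => [/eqP [_ ->] //|/eqP [_ ->]|]; first by rewrite /= !cn.
  by apply: oth; apply: cn.
- case/or3P => [/eqP [_ ->] //|/eqP [_ ->]|]; first by rewrite /= !cn.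
  by apply: oth; apply: cn.
- case/or3P => [/eqP [_ ->]|/eqP [_ ->]|]; rewrite /= ?cn //.
  by apply: oth; apply: cn.
- case/or4P => [/eqP [_ ->] //|/eqP [_ ->]|/eqP [_ ->]|]; rewrite /= ?cn //.
  by apply: oth; apply: cn.
Qed.

Lemma prods_nonempty X : 0 < nr -> prods X != [::].
Proof.
case: X => t r n0; case: t => [|[|[|[|[|[|[|[|t]]]]]]]] //=.
- by case: (nr) n0.
- by rewrite /letters addn1.
- by case: (onth p r) => [[i|i j]|].
Qed.

Lemma behead_nts t r : (t, r) \in behead nts -> t != 0.
Proof.
have -> : behead nts = [:: bad; anyw; tick] ++ [seq at_ pc | pc <- iota 0 (size p).+1] ++
  [seq (t, r) | t <- [:: 5; 6; 7; 8], r <- iota 0 nr] by [].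
rewrite mem_cat => /orP [|]; first by rewrite !inE => /or3P [] /eqP [->].
rewrite mem_cat => /orP [/mapP [pc _ [-> _]] //|/allpairsP [[t' r'] [/= tt _ [-> _]]]].
by move: tt; rewrite !inE => /or4P [] /eqP ->.
Qed.

Definition machine_system : system := path_system nts prods.

Lemma machine_valid : 0 < nr -> valid_instance (machine_system, 0, 1).
Proof.
move=> n0; split=> //.
by apply: (path_system_wf uniq_nts prods_nts) => X _; apply: prods_nonempty.
Qed.

Lemma machine_not_connected : ~ instance_connected (machine_system, 0, 1).
Proof.
(* The letter [incl 0] of [tick] is 1, hence positive. *)
by apply: (path_system_not_connected uniq_nts (X := tick) (k := 0) (Bs := [::])).
Qed.

Lemma machine_entailment nsel :
  0 < nsel -> entailment nsel (machine_system, 0, 1) <-> ~ halts p x.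
Proof.
move=> hsel; rewrite -traces_included.
exact: (path_system_entails uniq_nts prods_nts hsel (X := start) (Y := bad)).
Qed.

End Traces.

(** * Structured programs for register machines *)

Definition regs := nat -> nat.

Inductive cmd :=
  | CInc (r : nat)
  | CDec (r : nat)
  | CSkip
  | CSeq (c d : cmd)
  | CLoop (r : nat) (c : cmd).

Inductive exec : cmd -> regs -> regs -> Prop :=
  | ExecInc r R : exec (CInc r) R (set_reg R r (R r).+1)
  | ExecDec r R : exec (CDec r) R (set_reg R r (R r).-1)
  | ExecSkip R : exec CSkip R R
  | ExecSeq c d R1 R2 R3 :
      exec c R1 R2 -> exec d R2 R3 -> exec (CSeq c d) R1 R3
  | ExecStop r c R : R r = 0 -> exec (CLoop r c) R R
  | ExecLoop r c n R1 R2 R3 :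
      R1 r = n.+1 -> exec c (set_reg R1 r n) R2 -> exec (CLoop r c) R2 R3 ->
      exec (CLoop r c) R1 R3.

(* [o] is the address of the code, and [z] a register containing zero, used for
   unconditional jumps. *)
Fixpoint compile (z o : nat) (c : cmd) : program :=
  match c with
  | CInc r => [:: Inc r]
  | CDec r => [:: Dec r o.+1]
  | CSkip => [::]
  | CSeq c d =>
      let q := compile z o c in q ++ compile z (o + size q) d
  | CLoop r c =>
      let q := compile z o.+1 c in Dec r (o + size q).+2 :: rcons q (Dec z o)
  end.

Fixpoint regs_below (z : nat) (c : cmd) : bool :=
  match c with
  | CInc r | CDec r => r < z
  | CSkip => true
  | CSeq c d => regs_below z c && regs_below z d
  | CLoop r c => (r < z) && regs_below z c
  end.

Definition code_at (p : program) (o : nat) (q : program) : Prop :=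
  forall i, i < size q -> onth p (o + i) = onth q i.

Lemma code_at_cat p o q1 q2 :
  code_at p o (q1 ++ q2) <-> code_at p o q1 /\ code_at p (o + size q1) q2.
Proof.
split=> [H|[H1 H2] i]; first split=> i il.
- by rewrite H ?onth_cat ?il // size_cat ltn_addr.
- by rewrite -addnA H ?onth_cat ?size_cat ?ltn_add2l // ltnNge leq_addr /= addKn.
rewrite size_cat onth_cat; case: (ltnP i (size q1)) => [il _|il ilt]; first exact: (H1 i il).
by rewrite -[i in LHS](subnKC il) addnA H2 //; lia.
Qed.

Lemma code_at_cons p o a q :
  code_at p o (a :: q) <-> onth p o = Some a /\ code_at p o.+1 q.
Proof.
rewrite -cat1s code_at_cat addn1; split=> -[H1 H2]; split=> //.
  by rewrite -[o]addn0 H1.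
by case=> // _; rewrite addn0.
Qed.

Definition reaches (p : program) (c c' : config) : Prop :=
  exists n, iter n (step p) c = c'.

Lemma reaches_refl p c : reaches p c c.
Proof. by exists 0. Qed.

Lemma reaches_trans p c1 c2 c3 : reaches p c1 c2 -> reaches p c2 c3 -> reaches p c1 c3.
Proof. by move=> [n <-] [m <-]; exists (m + n); rewrite iterD. Qed.

Lemma reaches_step p c c' : step p c = c' -> reaches p c c'.
Proof. by move=> <-; exists 1. Qed.

Lemma exec_below z c R R' : exec c R R' -> regs_below z c -> R' z = R z.
Proof.
elim=> {c R R'} //= [r R rz|r R rz|c d R1 R2 R3 _ IH1 _ IH2|r c n R1 R2 R3 _ _ IH1 _ IH2].
- by rewrite /set_reg /= gtn_eqF.
- by rewrite /set_reg /= gtn_eqF.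
- by case/andP=> cz dz; rewrite IH2 // IH1.
- by case/andP=> rz cz; rewrite IH2 ?rz // IH1 // /set_reg /= gtn_eqF.
Qed.

(** The induction is on the evaluation rather than the command, because a loop re-enters its own
    code. *)
Lemma compile_correct p z c o R R' :
  exec c R R' -> regs_below z c -> R z = 0 -> code_at p o (compile z o c) ->
  reaches p (o, R) (o + size (compile z o c), R').
Proof.
move=> ev; elim: ev o => {c R R'} [r R|r R|R|c d R1 R2 R3 e1 IH1 _ IH2|
  r c R Rr|r c n R1 R2 R3 Rr e1 IH1 e2 IH2] o /=.
- move=> _ _ /code_at_cons [e _]; apply: reaches_step.
  by rewrite /= e addn1.
- move=> _ _ /code_at_cons [e _]; apply: reaches_step.
  rewrite /= e addn1; case Rr: (R r) => [|m] //; congr (_, _).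
  by apply: functional_extensionality => i; rewrite /set_reg /=; case: eqP => [->|].
- by move=> _ _ _; rewrite addn0; apply: reaches_refl.
- case/andP=> cz dz Rz /code_at_cat [k1 k2]; rewrite size_cat addnA.
  apply: reaches_trans (IH1 _ cz Rz k1) (IH2 _ dz _ k2).
  by rewrite (exec_below e1).
- move=> _ _ /code_at_cons [e _]; apply: reaches_step.
  by rewrite /= e Rr size_rcons !addnS.
case/andP=> rz cz Rz k; have := k; rewrite code_at_cons -cats1 code_at_cat code_at_cons.
case=> e [kc [ez _]].
have Rz1 : set_reg R1 r n z = 0 by rewrite /set_reg /= gtn_eqF.
apply: reaches_trans (_ : reaches p _ (o.+1, set_reg R1 r n)) _.
  by apply: reaches_step; rewrite /= e Rr.
apply: reaches_trans (IH1 _ cz Rz1 kc) _.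
have Rz2 : R2 z = 0 by rewrite (exec_below e1).
apply: reaches_trans (_ : reaches p _ (o, R2)) _.
  by apply: reaches_step; rewrite /step ez Rz2.
by have := IH2 o; rewrite /= cats1; apply; rewrite ?rz.
Qed.

Definition move (a b : nat) := CLoop a (CInc b).
Definition double (m t : nat) := CSeq (CLoop m (CSeq (CInc t) (CInc t))) (move t m).
Definition copy (a b t : nat) := CSeq (CLoop a (CSeq (CInc b) (CInc t))) (move t a).
Definition cons_cmd (a m t : nat) :=
  CSeq (CSeq (double m t) (CInc m)) (CLoop a (double m t)).

(** One step of [CodeSeq.code]: the code of [a :: s] when [m] is the code of [s]. In [cons_cmd], [m]
    becomes [2m + 1] and is then doubled [a] times. *)
Definition gcons (a m : nat) : nat := 2 ^ a * m.*2.+1.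
Arguments gcons : simpl never.

Ltac reg_ext := apply: functional_extensionality => i; rewrite /set_reg /= ?eqxx;
  repeat (case: eqVneq => ? //=; try subst; rewrite ?eqxx); try lia.

Lemma exec_eq c R R1 R2 : exec c R R1 -> R1 = R2 -> exec c R R2.
Proof. by move=> e <-. Qed.

Lemma exec_move a b R : a != b ->
  exec (move a b) R (set_reg (set_reg R b (R b + R a)) a 0).
Proof.
move=> ab; move e: (R a) => n; elim: n R e => [|n IH] R e.
  apply: exec_eq (ExecStop _ e) _; reg_ext.
apply: (ExecLoop e (ExecInc _ _)); apply: exec_eq (IH _ _) _.
  by rewrite /set_reg /= (negbTE ab) eqxx.
reg_ext.
Qed.

Lemma exec_spread a b t R : a != b -> a != t ->
  exec (CLoop a (CSeq (CInc b) (CInc t))) R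
    (fun i => if i == a then 0 else R i + R a * ((i == b) + (i == t))).
Proof.
move=> ab at'; move e: (R a) => n; elim: n R e => [|n IH] R e.
  apply: exec_eq (ExecStop _ e) _; apply: functional_extensionality => i.
  by case: eqP => [->|]; rewrite ?addn0.
apply: (ExecLoop e (ExecSeq (ExecInc _ _) (ExecInc _ _))); apply: exec_eq (IH _ _) _.
  by rewrite /set_reg /= (negbTE at') (negbTE ab) eqxx.
reg_ext.
Qed.

Lemma exec_double m t R : m != t -> R t = 0 ->
  exec (double m t) R (set_reg R m (R m).*2).
Proof.
move=> mt Rt; apply: ExecSeq (exec_spread _ mt mt) _.
apply: exec_eq (exec_move _ _) _; first by rewrite eq_sym.
reg_ext.
Qed.

Lemma exec_copy a b t R : a != b -> a != t -> b != t -> R t = 0 ->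
  exec (copy a b t) R (set_reg R b (R b + R a)).
Proof.
move=> ab at' bt Rt; apply: ExecSeq (exec_spread _ ab at') _.
apply: exec_eq (exec_move _ _) _; first by rewrite eq_sym.
reg_ext.
Qed.

Lemma exec_cons a m t R : a != m -> a != t -> m != t -> R t = 0 ->
  exec (cons_cmd a m t) R (set_reg (set_reg R m (gcons (R a) (R m))) a 0).
Proof.
move=> am at' mt Rt.
apply: ExecSeq (ExecSeq (exec_double mt Rt) (ExecInc _ _)) _.
have dbl n S : S a = n -> S t = 0 ->
    exec (CLoop a (double m t)) S (set_reg (set_reg S m (2 ^ n * S m)) a 0).
  elim: n S => [|n IH] S Sa St.
    apply: exec_eq (ExecStop _ Sa) _; apply: functional_extensionality => i.
    by rewrite /set_reg /= mul1n; case: eqP => [->|_] //; case: eqP => [->|].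
  apply: (ExecLoop Sa (exec_double mt _)); first by rewrite /set_reg /= eq_sym (negbTE at').
  apply: exec_eq (IH _ _ _) _; first by rewrite /set_reg /= (negbTE am) eqxx.
    by rewrite /set_reg /= ![t == _]eq_sym (negbTE mt) (negbTE at').
  apply: functional_extensionality => i; rewrite /set_reg /=.
  case: (eqVneq i a) => // ia; case: (eqVneq i m) => [im|//].
  by rewrite eqxx [m == a]eq_sym (negbTE am) expnS; lia.
apply: exec_eq (dbl (R a) _ _ _) _.
- by rewrite /set_reg /= (negbTE am).
- by rewrite /set_reg /= eq_sym (negbTE mt).
apply: functional_extensionality => i; rewrite /set_reg /= !eqxx /gcons.
by case: (i == a); case: (i == m).
Qed.

(* Register contents given by a list; register 7 is the scratch register of the
   macros below. *)
Definition env (s : seq nat) : regs := nth 0 s.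

Lemma env_set s r v : set_reg (env s) r v = env (set_nth 0 s r v).
Proof.
by apply: functional_extensionality => i; rewrite /env nth_set_nth.
Qed.

(** Straight-line code as data: its effect on a concrete list of registers is obtained by computing
    [op_run]. *)
Inductive op := OInc (r : nat) | ODec (r : nat) | OCons (a m : nat)
  | OCopy (a b : nat) | OMove (a b : nat).

Definition op_cmd (o : op) : cmd :=
  match o with
  | OInc r => CInc r
  | ODec r => CDec r
  | OCons a m => cons_cmd a m 7
  | OCopy a b => copy a b 7
  | OMove a b => move a b
  end.

Definition op_ok (o : op) : bool :=
  match o with
  | OInc r | ODec r => r < 7
  | OCons a b | OCopy a b | OMove a b => [&& a < 7, b < 7 & a != b]
  end.

Definition op_run (s : seq nat) (o : op) : seq nat :=
  let g := nth 0 s in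
  match o with
  | OInc r => set_nth 0 s r (g r).+1
  | ODec r => set_nth 0 s r (g r).-1
  | OCons a m => set_nth 0 (set_nth 0 s m (gcons (g a) (g m))) a 0
  | OCopy a b => set_nth 0 s b (g b + g a)
  | OMove a b => set_nth 0 (set_nth 0 s b (g b + g a)) a 0
  end.

Definition ops_cmd (os : seq op) : cmd := foldr (fun o => CSeq (op_cmd o)) CSkip os.

Lemma exec_op o s : op_ok o -> nth 0 s 7 = 0 ->
  exec (op_cmd o) (env s) (env (op_run s o)) /\ nth 0 (op_run s o) 7 = 0.
Proof.
move=> ok s7; have ne r : r < 7 -> (r != 7) /\ (7 == r) = false by lia.
case: o ok => [r|r|a b|a b|a b] /=.
- by case/ne=> _ r7; rewrite -env_set nth_set_nth /= r7; split=> //; apply: ExecInc.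
- by case/ne=> _ r7; rewrite -env_set nth_set_nth /= r7; split=> //; apply: ExecDec.
- case/and3P=> /ne [a7 ra] /ne [b7 rb] ab; rewrite -!env_set !nth_set_nth /= ra nth_set_nth /= rb.
  by split=> //; apply: exec_cons.
- case/and3P=> /ne [a7 ra] /ne [b7 rb] ab; rewrite -!env_set !nth_set_nth /= rb.
  by split=> //; apply: exec_copy.
- case/and3P=> /ne [a7 ra] /ne [b7 rb] ab; rewrite -!env_set !nth_set_nth /= ra nth_set_nth /= rb.
  by split=> //; apply: exec_move.
Qed.

Lemma exec_ops os s : all op_ok os -> nth 0 s 7 = 0 ->
  exec (ops_cmd os) (env s) (env (foldl op_run s os)).
Proof.
elim: os s => [|o os IH] s /=; first by move=> _ _; apply: ExecSkip.
case/andP=> ok oks s7; have [e s7'] := exec_op ok s7.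
exact: ExecSeq e (IH _ oks s7').
Qed.

(** * Computing the encoding of an instance *)

(* The machine system with input [x] depends on [x] only through the single rule
   of its first predicate, so that [enc_instance] of it is computed from [x]
   when [x] is itself the code of the other predicates.  Registers: 0 input and
   result, 1 loop counter, 2 next variable, 3 existential variables, 4 calls,
   5 and 6 work space. *)

Definition incs r n := nseq n (OInc r).

(** Establishes the invariant of [exec_iterations] at [m = 0]: the variable list [[:: 3]], the
    single call to predicate 4 with arguments 3 and 2, and the next variable 4. *)
Definition prologue : seq op :=
  [:: OCopy 0 1] ++ incs 2 4 ++ incs 5 3 ++ [:: OCons 5 3] ++
  incs 5 2 ++ [:: OCons 5 6] ++ incs 5 3 ++ [:: OCons 5 6] ++
  incs 5 4 ++ [:: OCons 5 6; OCons 6 4].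

Definition iteration : seq op :=
  [:: OCopy 2 5; ODec 5; OCons 5 6; OCopy 2 5; OCons 5 6] ++ incs 5 3 ++
  [:: OCons 5 6; OCons 6 4; OCopy 2 5; OCons 5 3; OInc 2].

(** The code is assembled from the inside out: rule, predicate, then the system, whose tail is the
    input still held in register 0, and finally the indices 0 and 1. *)
Definition epilogue : seq op :=
  [:: OCons 5 6; OCons 4 6; ODec 2; OCons 2 4; OInc 5; OCons 5 4; OCons 4 5;
      OCons 5 6; OCons 3 6; OCons 6 3; OCons 3 6] ++
  incs 5 2 ++ [:: OCons 5 3; OInc 5; OCons 5 3; OCons 3 6; OCons 6 0;
      OInc 5; OCons 5 6; OCons 5 6; OCons 0 6; OMove 6 0].

Definition encoder : cmd :=
  CSeq (ops_cmd prologue)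
    (CSeq (CLoop 1 (ops_cmd iteration)) (ops_cmd epilogue)).

Local Notation gn := CodeSeq.code.

Local Arguments CodeSeq.code : simpl never.

Lemma gnE a s : gn (a :: s) = gcons a (gn s).
Proof. by []. Qed.

(** 3 and 4 are the positions of [tick] and [at_ 0] in [nts]. *)
Definition start_calls (n : nat) := path_calls (nseq n 3 ++ [:: 4]).

Definition enc_vars n := gn (rev (iota 3 n.+1)).
Definition enc_calls n := gn [seq gn (c.1 :: c.2) | c <- start_calls n].

Lemma enc_varsS n : enc_vars n.+1 = gcons (4 + n) (enc_vars n).
Proof.
rewrite /enc_vars -gnE; congr gn.
by rewrite -[n.+2]addn1 iotaD rev_cat /= addnS addSnnS.
Qed.

Lemma enc_callsS n :
  enc_calls n.+1 = gcons (gcons 3 (gcons (4 + n) (gcons (3 + n) 0))) (enc_calls n).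
Proof.
rewrite /enc_calls /start_calls /= !gnE size_cat size_nseq /= addn1.
by rewrite !addnS !addSn !add0n.
Qed.

Lemma exec_iterations x n m :
  exec (CLoop 1 (ops_cmd iteration))
    (env [:: x; n; 4 + m; enc_vars m; enc_calls m; 0; 0; 0])
    (env [:: x; 0; 4 + (m + n); enc_vars (m + n); enc_calls (m + n); 0; 0; 0]).
Proof.
elim: n m => [|n IH] m; first by rewrite addn0; apply: ExecStop.
rewrite addnS -addSn.
apply: (@ExecLoop 1 _ n _ _ _ _ _ (IH m.+1)) => //.
rewrite env_set; apply: exec_eq (exec_ops _ _) _ => //.
congr env; rewrite enc_varsS enc_callsS.
rewrite [foldl _ _ _]/= ?addn0 ?add0n.
by rewrite ?addnS ?addSn ?add0n.
Qed.

Definition start_predicate (x : nat) : predicate :=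
  Predicate [:: 1; 2] [:: path_rule 0 (nseq x 3 ++ [:: 4])].

Definition enc_result (x : nat) : nat :=
  gn [:: gcons (enc_predicate (start_predicate x)) x; 0; 1].

Lemma enc_start_predicate x :
  enc_predicate (start_predicate x) =
  gcons (gcons 1 (gcons 2 0)) (gcons (gcons
    (gcons (enc_vars x) (gcons (gcons (gcons 1 (gcons (3 + x) 0)) 0)
      (gcons (enc_calls x) (gcons 0 0)))) 0) 0).
Proof.
rewrite /enc_predicate /enc_rule /= !gnE -/(start_calls x) -/(enc_calls x).
by rewrite !size_cat size_nseq /= addn0 addn1 -/(enc_vars x) addnS.
Qed.

Lemma exec_encoder x :
  exec encoder (env [:: x; 0; 0; 0; 0; 0; 0; 0])
    (env [:: enc_result x; 0; 0; 0; 0; 0; 0; 0]).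
Proof.
apply: ExecSeq (exec_ops _ _) (ExecSeq _ _) => //.
  apply: (exec_eq (c := CLoop _ _)); last by [].
  have := exec_iterations x x 0; rewrite add0n.
  by rewrite /enc_vars /enc_calls /start_calls /= !gnE; apply.
apply: exec_eq (exec_ops _ _) _ => //.
congr env; rewrite /enc_result !gnE enc_start_predicate.
by rewrite [foldl _ _ _]/= ?addn0 ?add0n.
Qed.

Lemma init_env x : (init x).2 = env [:: x; 0; 0; 0; 0; 0; 0; 0].
Proof.
by apply: functional_extensionality => -[|[|[|[|[|[|[|[|i]]]]]]]] //=; rewrite /env nth_nil.
Qed.

Lemma encoder_below z : 7 < z -> regs_below z encoder.
Proof. by move=> z7; rewrite /=; repeat (apply/andP; split => //); lia. Qed.

(** The input 0 is arbitrary: the predicates after the first do not depend on it, so their code can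
    itself serve as the input without circularity. *)
Definition codes_tail (p : program) (nr : nat) : nat :=
  gn (behead (map enc_predicate (machine_system p nr 0))).

Lemma enc_machine p nr :
  let x := codes_tail p nr in
  enc_instance (machine_system p nr x, 0, 1) = enc_result x.
Proof.
move=> x; rewrite /enc_instance /enc_result; congr (gn [:: _; 0; 1]).
have e : machine_system p nr x =
    start_predicate x :: behead (machine_system p nr 0).
  have -> : machine_system p nr x = start_predicate x ::
      map (path_predicate (nts p nr) (prods p nr x)) (behead (nts p nr)).
    congr (_ :: _); rewrite /path_predicate /start_predicate /=.
    by rewrite map_cat map_nseq.
  rewrite /machine_system /path_system behead_map; congr (_ :: _).
  apply/eq_in_map => -[t r] tr; rewrite /path_predicate; congr Predicate.
  by have := behead_nts tr; case: t {tr}.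
by rewrite e map_cons gnE /x /codes_tail behead_map.
Qed.

(** * Diagonalization *)

(** A jump out of [p] is redirected to the address just after its copy, where the following code
    starts. *)
Definition relocate (o : nat) (p : program) : program :=
  [seq match i with
       | Inc r => Inc r
       | Dec r j => Dec r (o + minn j (size p))
       end | i <- p].

Lemma relocate_correct q o p c n :
  code_at q o (relocate o p) ->
  reaches q (o + minn c.1 (size p), c.2)
    (o + minn (iter n (step p) c).1 (size p), (iter n (step p) c).2).
Proof.
move=> k; elim: n => [|n IH]; first exact: reaches_refl.
apply: reaches_trans IH _; rewrite iterS; case: (iter n (step p) c) => pc R /=.
have [pl|pg] := boolP (pc < size p); last first.
  by rewrite -leqNgt in pg; rewrite onth_default //; apply: reaches_refl.
have := k pc; rewrite size_map onth_map => /(_ pl) kpc.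
apply: reaches_step; rewrite /step (minn_idPl (ltnW pl)) kpc.
have : onth p pc by rewrite onthTE.
case: (onth p pc) => [[r|r j]|] //= _.
  by rewrite (minn_idPl pl) addnS.
by case: (R r) => [|m] //=; rewrite (minn_idPl pl) addnS.
Qed.

Lemma iter_untouched p z n c :
  (forall i a, onth p i = Some a -> instr_reg a < z) ->
  (iter n (step p) c).2 z = c.2 z.
Proof.
move=> pz; elim: n => //= n <-; case: (iter n (step p) c) => pc R /=.
case e: (onth p pc) => [a|] //; have := pz _ _ e.
case: a {e} => [r|r j] /= rz; first by rewrite /set_reg /= gtn_eqF.
by case: (R r) => //= m; rewrite /set_reg /= gtn_eqF.
Qed.

Lemma regs_bounded (p : program) :
  exists z, forall i a, onth p i = Some a -> instr_reg a < z.
Proof.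
elim: p => [|b p [z pz]]; first by exists 0 => i a; rewrite onth0n.
exists (maxn z (instr_reg b).+1) => -[|i] a /=; first by case=> <-; lia.
by move/pz; lia.
Qed.

Lemma halts_reaches p x c : reaches p (init x) c -> size p <= c.1 -> halts p x.
Proof. by move=> [n <-] h; exists n. Qed.

Lemma not_halts_fixpoint p x c :
  reaches p (init x) c -> step p c = c -> c.1 < size p -> ~ halts p x.
Proof.
move=> [n nc] fix_c cp [m hm].
have fixed k : iter k (step p) c = c by elim: k => //= k ->.
have stuck d k : size p <= d.1 -> iter k (step p) d = d.
  by case: d => pc R h; elim: k => //= k ->; rewrite /= onth_default.
have : iter (n + m) (step p) (init x) = c by rewrite addnC iterD nc fixed.
rewrite iterD stuck // => e; move: hm; rewrite e leqNgt.
by rewrite cp.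
Qed.

Lemma encoder_program z : 7 < z ->
  exists e, forall q x, code_at q 0 e ->
    reaches q (init x) (size e, (init (enc_result x)).2).
Proof.
move=> z7; exists (compile z 0 encoder) => q x k.
rewrite init_env [init x]surjective_pairing init_env.
apply: (compile_correct (exec_encoder x) (encoder_below z7) _ k).
by rewrite /env nth_default.
Qed.

(* The last three instructions halt if and only if register 0 contains 1. *)
Definition diagonal (z : nat) (e p : program) : program :=
  let o := size e + size p in
  (e ++ relocate (size e) p) ++ [:: Dec 0 o.+2; Dec 0 o.+3; Dec z o.+2].

(** The answer 0 jumps to the last instruction, 1 jumps past the end, and a larger answer falls
    through to the last instruction, which loops forever. *)
Lemma diagonal_halts z e p x x' y :
  0 < z -> (forall i a, onth p i = Some a -> instr_reg a < z) ->
  (forall q, code_at q 0 e -> reaches q (init x) (size e, (init x').2)) ->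
  computes p x' y -> (halts (diagonal z e p) x <-> y = 1).
Proof.
move=> z0 pz he [n [hp yE]]; set D := diagonal z e p.
pose o := size e + size p; pose c := iter n (step p) (init x').
have : code_at D 0 D by move=> i _; rewrite add0n.
rewrite {2}/D /diagonal -/o !code_at_cat size_cat size_map -/o !add0n.
case=> [[ke kp]]; rewrite !code_at_cons => -[k0 [k1 [k2 _]]].
have sD : size D = o.+3.
  by rewrite /D /diagonal -/o !size_cat size_map /= -/o addn3.
(* Register [z] stays zero, so the final [Dec z o.+2] jumps to itself. *)
have cz : c.2 z = 0 by rewrite iter_untouched //= gtn_eqF.
have r1 : reaches D (init x) (o, c.2).
  apply: reaches_trans (he _ ke) _.
  have := relocate_correct (init x') n kp.
  by rewrite -/c min0n addn0 (minn_idPr hp).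
have stop v : c.2 0 = v.+1 ->
    reaches D (init x) (if v is 0 then (o.+3, set_reg c.2 0 0)
                        else (o.+2, set_reg (set_reg c.2 0 v) 0 v.-1)).
  move=> cv; apply: reaches_trans r1 _.
  apply: reaches_trans (_ : reaches D _ (o.+1, set_reg c.2 0 v)) _.
    by apply: reaches_step; rewrite /step k0 cv.
  by apply: reaches_step; rewrite /step k1 {1}/set_reg /=; case: v {cv}.
rewrite -/c in yE; case: y yE => [|[|v]] yE.
- split=> // H; exfalso; apply: (not_halts_fixpoint (c := (o.+2, c.2))) H.
  + by apply: reaches_trans r1 _; apply: reaches_step; rewrite /step k0 yE.
  + by rewrite /step k2 cz.
  + by rewrite sD.
- by split=> // _; apply: (halts_reaches (stop _ yE)); rewrite sD.
- split=> // H; exfalso; apply: (not_halts_fixpoint (stop _ yE)) H; last by rewrite sD.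
  by rewrite /step k2 /set_reg /= gtn_eqF // cz.
Qed.

Theorem theorem2 (nsel : nat) (hsel : 0 < nsel) :
  ~ decidable_on enc_instance valid_instance (entailment nsel) /\
  ~ decidable_on enc_instance
      (fun I => valid_instance I /\ ~ instance_connected I)
      (entailment nsel).
Proof.
have main : ~ decidable_on enc_instance
    (fun I => valid_instance I /\ ~ instance_connected I) (entailment nsel).
  case=> p dec; have [z0 pz0] := regs_bounded p.
  (* The encoder uses registers 0 to 7, so [z] is outside both the encoder and [p]. *)
  pose z := maxn z0 8; have z7 : 7 < z by rewrite /z; lia.
  have zpos : 0 < z by exact: leq_trans z7.
  have pz i a : onth p i = Some a -> instr_reg a < z by move/pz0; rewrite /z; lia.
  have [e he] := encoder_program z7.
  have [nr0 Dnr0] := regs_bounded (diagonal z e p).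
  pose D := diagonal z e p; pose nr := nr0.+1.
  have Dnr i a : onth D i = Some a -> instr_reg a < nr.
    by move/Dnr0; rewrite /nr; lia.
  (* [D] and [nr] are fixed before [x]. On input [x], [D] runs [p] on the code of [I], an instance
     about this same run. *)
  pose x := codes_tail D nr; pose I := (machine_system D nr x, 0, 1).
  have [] := dec I; first by split; [exact: machine_valid|exact: machine_not_connected].
  (* [D] halts on [x] iff the answer [y] is 1, iff the entailment holds, iff [D] does not halt on
     [x]. *)
  move=> y; rewrite enc_machine -/x => -[/(diagonal_halts zpos pz (he^~ x)) hD].
  by rewrite (machine_entailment x Dnr hsel) -hD; tauto.
(* A machine correct on all valid instances is correct on the non-connected ones. *)
split=> // -[p dec]; apply: main; exists p => I [vI _]; exact: dec.
Qed.
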